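(* Define class-function-valued polynomials $Q_i$ in the variables $X_1,Y_1,X_2,Y_2,\dots$ by the generating function \[ \sum_{i=0}^\infty Q_i\, t^i = \prod_{k=1}^\infty \frac{1-t^{2k}}{(1-t^k)^{X_k}(1+t^k)^{Y_k}} = \prod_{k=1}^\infty\left(\sum_{j=0}^\infty \binom{1-X_k}{j}(-t^k)^j\right)\left(\sum_{j=0}^\infty\binom{1-Y_k}{j}(t^k)^j\right). \] Then for every integer $n\ge 1$, the character of the $B_n$-representation $R_n^i$ satisfies $\chi_{R_n^i} = Q_i$ (as functions on $B_n$) for all $i \leq 2n+1$.
   Context: $B_n$ is the hyperoctahedral group (signed permutations), acting on $\mathbb{C}[x_1,\dots,x_n]$ by permuting and negating the variables. $R_n^* = \mathbb{C}[x_1,\dots,x_n]/I_n$ is the type B/C coinvariant algebra, $I_n$ the ideal generated by $B_n$-invariant polynomials with zero constant term, and $R_n^i$ its $i$-th graded piece. A hyperoctahedral character polynomial is an element of $\mathbb{Q}[X_1,Y_1,X_2,Y_2,\dots]$, evaluated on $\sigma\in B_n$ by setting $X_r=X_r(\sigma)$, the number of positive $r$-cycles of $\sigma$, and $Y_r=Y_r(\sigma)$, the number of negative $r$-cycles; here $\binom{1-X_k}{j}$ denotes the polynomial $(1-X_k)(-X_k)\cdots(2-j-X_k)/j!$. *)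

(* Defs.v *)
From HB Require Import structures.
From mathcomp Require Import all_boot all_order all_algebra all_fingroup.
From mathcomp Require Import ring_quotient generic_quotient finmap.
From mathcomp Require Import boolp classical_sets reals complex.
From mathcomp Require Import monalg mpoly.

Set Implicit Arguments.
Unset Strict Implicit.
Unset Printing Implicit Defensive.

Import GRing.Theory.
Local Open Scope ring_scope.
Local Open Scope quotient_scope.

(* The signed permutation e_i |-> (-1)^(sp_neg i) e_(sp_perm i).  As for
   {perm T}, the product s * t means "s first, then t".                       *)
Record signed_perm (n : nat) := SignedPerm {
  sp_perm : {perm 'I_n};
  sp_neg : {ffun 'I_n -> bool} }.

Section SignedPermGroup.
Context {n : nat}.
Implicit Types s t u : signed_perm n.

Definition pair_of_sp s := (sp_perm s, sp_neg s).
Definition sp_of_pair x := SignedPerm (n := n) x.1 x.2.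
Lemma pair_of_spK : cancel pair_of_sp sp_of_pair.
Proof. by case. Qed.

HB.instance Definition _ := Countable.copy (signed_perm n) (can_type pair_of_spK).
HB.instance Definition _ : isFinite (signed_perm n) := CanIsFinite pair_of_spK.

Definition sp_mul s t := SignedPerm (sp_perm s * sp_perm t)%g
  [ffun i => sp_neg s i (+) sp_neg t (sp_perm s i)].
Definition sp_one := SignedPerm (n := n) 1%g [ffun=> false].
Definition sp_inv s := SignedPerm (sp_perm s)^-1%g
  [ffun i => sp_neg s ((sp_perm s)^-1%g i)].

Lemma sp_mulA : associative sp_mul.
Proof.
move=> s t u; rewrite /sp_mul /= mulgA; congr SignedPerm.
by apply/ffunP => i; rewrite !ffunE permM addbA.
Qed.
Lemma sp_mul1 : left_id sp_one sp_mul.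
Proof.
case=> s e; rewrite /sp_mul /= mul1g; congr SignedPerm.
by apply/ffunP => i; rewrite !ffunE perm1.
Qed.
Lemma sp_mulV : left_inverse sp_one sp_inv sp_mul.
Proof.
case=> s e; rewrite /sp_mul /= mulVg; congr SignedPerm.
by apply/ffunP => i; rewrite !ffunE addbb.
Qed.
HB.instance Definition _ :=
  Finite_isGroup.Build (signed_perm n) sp_mulA sp_mul1 sp_mulV.
End SignedPermGroup.

(* A cycle of s is negative when it carries an odd number of sign changes.    *)
Definition cycle_neg n (s : signed_perm n) (c : {set 'I_n}) : bool :=
  \big[addb/false]_(i in c) sp_neg s i.

(* X_r(s) is ncycles s false r and Y_r(s) is ncycles s true r.                *)
Definition ncycles n (s : signed_perm n) (b : bool) (r : nat) : nat :=
  #|[set c in porbits (sp_perm s) | (#|c| == r) && (cycle_neg s c == b)]|.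

(* Q[X_1, Y_1, X_2, Y_2, ...]; the variable of index (b, r) is X_r or Y_r
   according as b is false or true.  The index r = 0 is never used.           *)
Definition charpoly := {malg rat[{cmonom (bool * nat)%type}]}.
HB.instance Definition _ := GRing.ComAlgebra.on charpoly.

Definition Xvar (r : nat) : charpoly := << ucm (false, r) >>.
Definition Yvar (r : nat) : charpoly := << ucm (true, r) >>.

Section CharpolyEval.
Context {n : nat} (s : signed_perm n).

Definition monom_eval (m : {cmonom (bool * nat)%type}) : rat :=
  \prod_(v <- finsupp m) (ncycles s v.1 v.2)%:R ^+ m v.

Lemma monom_evalE (d : {fset (bool * nat)%type}) (m : {cmonom (bool * nat)%type}) : (finsupp m `<=` d)%fset ->
  monom_eval m = \prod_(v <- d) (ncycles s v.1 v.2)%:R ^+ m v.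
Proof.
move=> sub; rewrite /monom_eval (big_fset_incl _ sub) // => v _ vm.
by rewrite memNfinsupp in vm; rewrite (eqP vm) expr0.
Qed.

Lemma monom_eval_mmorphism : mmorphism monom_eval.
Proof.
split=> [m1 m2|]; last by rewrite /monom_eval mdom1 big_seq_fset0.
rewrite (@monom_evalE (finsupp m1 `|` finsupp m2)%fset) ?mdomD //.
rewrite (@monom_evalE (finsupp m1 `|` finsupp m2)%fset m1) ?fsubsetUl //.
rewrite (@monom_evalE (finsupp m1 `|` finsupp m2)%fset m2) ?fsubsetUr //.
by rewrite -big_split; apply: eq_bigr => v _; rewrite cmM exprD.
Qed.
HB.instance Definition _ :=
  monalg.isMultiplicative.Build _ _ monom_eval monom_eval_mmorphism.

Definition charpoly_eval (P : charpoly) : rat :=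
  monalg.mmap (@idfun rat) monom_eval P.

Lemma charpoly_eval_monoid_morphism : monoid_morphism charpoly_eval.
Proof.
by split=> [|P P']; [exact: (rmorph1 (monalg.mmap idfun monom_eval))
                    | exact: (rmorphM (monalg.mmap idfun monom_eval))].
Qed.
Lemma charpoly_eval_linear : scalar charpoly_eval.
Proof. by move=> c P P'; exact: (linearP (monalg.mmap idfun monom_eval)). Qed.

Lemma charpoly_evalX r : charpoly_eval (Xvar r) = (ncycles s false r)%:R.
Proof.
by rewrite /charpoly_eval mmapU mul1r /monom_eval mdomU big_seq_fset1 cmUU expr1.
Qed.
Lemma charpoly_evalY r : charpoly_eval (Yvar r) = (ncycles s true r)%:R.
Proof.
by rewrite /charpoly_eval mmapU mul1r /monom_eval mdomU big_seq_fset1 cmUU expr1.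
Qed.
End CharpolyEval.

Record fps (A : Type) := Fps { fcoef : nat -> A }.

Section FpsRing.
Context {A : comNzRingType}.
Implicit Types f g h : fps A.

HB.instance Definition _ := gen_eqMixin (fps A).
HB.instance Definition _ := gen_choiceMixin (fps A).

Lemma fpsP f g : fcoef f =1 fcoef g -> f = g.
Proof. by case: f g => [f] [g] /= /funext ->. Qed.

Definition fzero : fps A := Fps (fun=> 0).
Definition fopp f : fps A := Fps (fun n => - fcoef f n).
Definition fadd f g : fps A := Fps (fun n => fcoef f n + fcoef g n).
Definition fone : fps A := Fps (fun n => (n == 0)%:R).
Definition fmul f g : fps A :=
  Fps (fun n => \sum_(j < n.+1) fcoef f j * fcoef g (n - j)%N).

Lemma faddA : associative fadd.
Proof. by move=> f g h; apply/fpsP => n /=; rewrite addrA. Qed.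
Lemma faddC : commutative fadd.
Proof. by move=> f g; apply/fpsP => n /=; rewrite addrC. Qed.
Lemma fadd0 : left_id fzero fadd.
Proof. by move=> f; apply/fpsP => n /=; rewrite add0r. Qed.
Lemma faddN : left_inverse fzero fopp fadd.
Proof. by move=> f; apply/fpsP => n /=; rewrite addNr. Qed.
HB.instance Definition _ :=
  GRing.isZmodule.Build (fps A) faddA faddC fadd0 faddN.

Definition ftrunc n f : {poly A} := \poly_(j < n.+1) fcoef f j.

Lemma fcoef_mulE n m f g : (m <= n)%N ->
  fcoef (fmul f g) m = (ftrunc n f * ftrunc n g)`_m.
Proof.
move=> le_mn; rewrite coefM; apply: eq_bigr => -[j /= lt_jm] _.
rewrite ltnS in lt_jm.
by rewrite !coef_poly !ltnS (leq_trans lt_jm) // (leq_trans (leq_subr _ _)).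
Qed.

Lemma fmulC : commutative fmul.
Proof. by move=> f g; apply/fpsP => n; rewrite !(@fcoef_mulE n) // mulrC. Qed.
Lemma fmulA : associative fmul.
Proof.
move=> f g h; apply/fpsP => n.
transitivity (ftrunc n f * (ftrunc n g * ftrunc n h))`_n.
  rewrite coefM; apply: eq_bigr => -[j /= lt_jn] _.
  rewrite -(@fcoef_mulE n) ?leq_subr //; congr (_ * _).
  by rewrite coef_poly lt_jn.
rewrite mulrA coefM; apply: eq_bigr => -[j /= lt_jn] _.
rewrite -(@fcoef_mulE n) //; congr (_ * _).
by rewrite coef_poly ltnS leq_subr.
Qed.
Lemma fmul1 : left_id fone fmul.
Proof.
move=> f; apply/fpsP => n /=; rewrite big_ord_recl /= mul1r subn0.
by rewrite big1 ?addr0 // => j _; rewrite mul0r.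
Qed.
Lemma fmulDl : left_distributive fmul fadd.
Proof.
move=> f g h; apply/fpsP => n /=; rewrite -big_split /=.
by apply: eq_bigr => j _; rewrite mulrDl.
Qed.
Lemma fone_neq0 : fone != 0.
Proof.
by apply/eqP => /(congr1 (fun f => fcoef f 0)) /= /eqP; rewrite oner_eq0.
Qed.
HB.instance Definition _ := GRing.Zmodule_isComNzRing.Build (fps A)
  fmulA fmulC fmul1 fmulDl fone_neq0.

Definition ft : fps A := Fps (fun n => (n == 1%N)%:R).

(* The substitution sum_j (a j) u^j, meaningful when u has zero constant term:
   then u^j contributes nothing in degree n once j > n.                       *)
Definition fsubst (a : nat -> A) (u : fps A) : fps A :=
  Fps (fun n => \sum_(j < n.+1) a j * fcoef (u ^+ j) n).

(* 1 / f, for f with constant term 1.                                         *)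
Definition finv f : fps A := fsubst (fun=> 1) (1 - f).

(* G is the product of the F k over all k >= 1, in the t-adic topology.       *)
Definition is_fprod (F : nat -> fps A) (G : fps A) : Prop :=
  forall i, exists N0, forall N, (N0 <= N)%N ->
    fcoef (\prod_(1 <= k < N) F k) i = fcoef G i.

End FpsRing.
Arguments ft {A}.

Section BinomialSeries.
Context {A : comAlgType rat}.

Definition binc (e : A) (j : nat) : A :=
  (j`!%:R^-1 : rat) *: \prod_(m < j) (e - m%:R).

(* (1 + u)^e *)
Definition fbinpow (u : fps A) (e : A) : fps A := fsubst (binc e) u.
End BinomialSeries.

Definition factor_frac (k : nat) : fps charpoly :=
  (1 - ft ^+ (2 * k))
    * finv (fbinpow (- ft ^+ k) (Xvar k) * fbinpow (ft ^+ k) (Yvar k)).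

Definition factor_bin (k : nat) : fps charpoly :=
  fbinpow (- ft ^+ k) (1 - Xvar k) * fbinpow (ft ^+ k) (1 - Yvar k).

(* The coefficient of t^i in the infinite product of the factor_frac k; the
   factors with k > i are 1 modulo t^(i+1).                                   *)
Definition Qpoly (i : nat) : charpoly :=
  fcoef (\prod_(1 <= k < i.+1) factor_frac k) i.

Section Coinvariants.
Context (F : fieldType) (n : nat).
Local Notation S := {mpoly F[n]}.
Implicit Types (s t : signed_perm n) (p q : S).

(* A right action, matching the order of composition in signed_perm.          *)
Definition sp_act s p : S :=
  p \mPo [tuple (-1) ^+ sp_neg s i *: 'X_(sp_perm s i) | i < n].

HB.instance Definition _ s := GRing.LRMorphism.copy (sp_act s)
  (comp_mpoly [tuple (-1) ^+ sp_neg s i *: 'X_(sp_perm s i) | i < n]).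

Lemma sp_actX s i : sp_act s 'X_i = (-1) ^+ sp_neg s i *: 'X_(sp_perm s i).
Proof. by rewrite /sp_act comp_mpolyXU -tnth_nth tnth_mktuple. Qed.

Lemma lrmorph_mpoly_ext (f g : {lrmorphism S -> S}) :
  (forall i, f 'X_i = g 'X_i) -> f =1 g.
Proof.
move=> fg p; rewrite [p]mpolyE !linear_sum; apply: eq_bigr => m _.
rewrite !linearZ /=; congr (_ *: _).
rewrite mpolyXE_id !rmorph_prod; apply: eq_bigr => i _.
by rewrite !rmorphXn /= fg.
Qed.

Lemma sp_act1 p : sp_act 1%g p = p.
Proof.
have := @lrmorph_mpoly_ext (sp_act 1%g) idfun; apply => i.
by rewrite /= sp_actX ffunE perm1 expr0 scale1r.
Qed.

Lemma sp_actM s t p : sp_act (s * t)%g p = sp_act t (sp_act s p).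
Proof.
have := @lrmorph_mpoly_ext (sp_act (s * t)%g) (sp_act t \o sp_act s); apply => i.
by rewrite /= !sp_actX linearZ /= sp_actX scalerA ffunE permM signr_addb.
Qed.

Lemma sp_act_dhomog s d p : p \is d.-homog -> sp_act s p \is d.-homog.
Proof.
move=> hp; rewrite [p]mpolyE linear_sum big_seq rpred_sum //= => m mp.
rewrite linearZ /= rpredZ // /sp_act comp_mpolyX -(dhomogP _ _ _ hp m mp) /= mpoly.mdegE.
elim/big_rec2: _ => [|i d' q _ hq]; first exact: dhomog1.
apply: dhomogM => //; rewrite tnth_mktuple -[X in X.-homog]mul1n.
by apply: dhomogMn; rewrite rpredZ // dhomogX /= mdeg1.
Qed.

Definition sp_invariant p : Prop := forall s, sp_act s p = p.

(* The ideal I_n: finite sums of multiples of the generators.                 *)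
Definition coinv_ideal : pred S := fun p =>
  `[< exists l : seq (S * S),
        (forall x, x \in l -> sp_invariant x.2 /\ x.2@_0%MM = 0)
        /\ p = \sum_(x <- l) x.1 * x.2 >].

Lemma coinv_ideal_closed : idealr_closed coinv_ideal.
Proof.
split.
- by apply/asboolP; exists [::]; rewrite big_nil.
- apply/negP => /asboolP[l [lP /(congr1 (mcoeff 0%MM))]].
  rewrite mcoeff1 eqxx raddf_sum big_seq big1 /= => [/eqP|x /lP[_ x0]].
    by rewrite oner_eq0.
  by rewrite rmorphM /= x0 mulr0.
- move=> a u v /asboolP[l [lP ->]] /asboolP[l' [lP' ->]]; apply/asboolP.
  exists ([seq (a * x.1, x.2) | x <- l] ++ l'); split.
    by move=> x; rewrite mem_cat => /orP[/mapP[y /lP Py ->]|/lP'].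
  rewrite big_cat big_map mulr_sumr; congr (_ + _).
  by apply: eq_bigr => x _; rewrite mulrA.
Qed.
HB.instance Definition _ := isIdealr.Build S coinv_ideal coinv_ideal_closed.

Lemma sp_act_ideal s p : p \in coinv_ideal -> sp_act s p \in coinv_ideal.
Proof.
move=> /asboolP[l [lP ->]]; apply/asboolP.
exists [seq (sp_act s x.1, x.2) | x <- l]; split.
  by move=> x /mapP[y /lP Py ->].
rewrite rmorph_sum big_map !big_seq; apply: eq_bigr => x /lP[inv_x _].
by rewrite rmorphM /= inv_x.
Qed.

Definition coinv_idealr : idealr S := coinv_ideal.

(* R_n^* *)
Definition coinv : Type := {ideal_quot coinv_idealr}.
HB.instance Definition _ := GRing.ComNzRing.on coinv.
Definition coinv_pi (p : S) : coinv := \pi_({ideal_quot coinv_idealr}) p.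
HB.instance Definition _ := GRing.RMorphism.copy coinv_pi
  (\pi_({ideal_quot coinv_idealr}) : S -> {ideal_quot coinv_idealr}).

Lemma coinv_piP p q : coinv_pi p = coinv_pi q <-> p - q \in coinv_ideal.
Proof.
rewrite Quotient.idealrBE; split; first by move=> ?; exact/eqP.
by move/eqP.
Qed.

Definition coinv_scale (c : F) (u : coinv) : coinv := coinv_pi c%:MP * u.
Lemma coinv_scaleA a b u : coinv_scale a (coinv_scale b u) = coinv_scale (a * b) u.
Proof. by rewrite /coinv_scale mulrA -rmorphM -mpolyCM. Qed.
Lemma coinv_scale1 : left_id 1 coinv_scale.
Proof. by move=> u; rewrite /coinv_scale mpolyC1 rmorph1 mul1r. Qed.
Lemma coinv_scaleDr : right_distributive coinv_scale +%R.
Proof. by move=> c u v; rewrite /coinv_scale mulrDr. Qed.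
Lemma coinv_scaleDl u : {morph coinv_scale^~ u : a b / a + b}.
Proof. by move=> a b; rewrite /coinv_scale mpolyCD rmorphD mulrDl. Qed.
HB.instance Definition _ := GRing.Zmodule_isLmodule.Build F coinv
  coinv_scaleA coinv_scale1 coinv_scaleDr coinv_scaleDl.

Lemma coinv_piZ c p : coinv_pi (c *: p) = c *: coinv_pi p.
Proof. by rewrite -mul_mpolyC rmorphM. Qed.

Definition coinv_act s (u : coinv) : coinv :=
  coinv_pi (sp_act s (repr (u : {ideal_quot coinv_idealr}))).

Lemma coinv_act_pi s p : coinv_act s (coinv_pi p) = coinv_pi (sp_act s p).
Proof.
apply/coinv_piP; rewrite -rmorphB; apply: sp_act_ideal.
by apply/coinv_piP; rewrite /coinv_pi reprK.
Qed.

(* R_n^i *)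
Definition coinv_graded (i : nat) (u : coinv) : Prop :=
  exists2 p : S, p \is i.-homog & u = coinv_pi p.

Lemma coinv_pi_surj (u : coinv) : exists p, u = coinv_pi p.
Proof. by exists (repr (u : {ideal_quot coinv_idealr})); rewrite /coinv_pi reprK. Qed.

Lemma coinv_act_linear s : linear (coinv_act s).
Proof.
move=> c u v; have [p ->] := coinv_pi_surj u; have [q ->] := coinv_pi_surj v.
by rewrite -coinv_piZ -rmorphD !coinv_act_pi -coinv_piZ -rmorphD linearP.
Qed.
Lemma coinv_act1 u : coinv_act 1%g u = u.
Proof. by have [p ->] := coinv_pi_surj u; rewrite coinv_act_pi sp_act1. Qed.
Lemma coinv_actM s t u : coinv_act (s * t)%g u = coinv_act t (coinv_act s u).
Proof. by have [p ->] := coinv_pi_surj u; rewrite !coinv_act_pi sp_actM. Qed.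
Lemma coinv_act_graded s i u :
  coinv_graded i u -> coinv_graded i (coinv_act s u).
Proof.
move=> [p hp ->]; exists (sp_act s p); first exact: sp_act_dhomog.
exact: coinv_act_pi.
Qed.
End Coinvariants.

Section Trace.
Context {F : fieldType} {V : lmodType F}.

Definition is_basis (W : V -> Prop) m (b : 'I_m -> V) : Prop :=
  [/\ forall i, W (b i),
      forall c : 'I_m -> F, \sum_i c i *: b i = 0 -> forall i, c i = 0
    & forall w, W w -> exists c : 'I_m -> F, w = \sum_i c i *: b i].

Definition is_trace (W : V -> Prop) (f : V -> V) (t : F) : Prop :=
  exists m (b : 'I_m -> V) (M : 'M[F]_m),
    [/\ is_basis W b, forall i, f (b i) = \sum_j M i j *: b j & t = \tr M].

(* The trace of the endomorphism f of the finite-dimensional subspace W.      *)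
Definition trace_on (W : V -> Prop) (f : V -> V) : F := xget 0 (is_trace W f).

Lemma is_trace_uniq W (f : {linear V -> V}) t t' :
  is_trace W f t -> is_trace W f t' -> t = t'.
Proof.
move=> [m [b [M [[bW bfree bgen] fb ->]]]] [m' [b' [M' [[bW' bfree' bgen'] fb' ->]]]].
have freeE k (e : 'I_k -> V) : (forall c : 'I_k -> F, \sum_i c i *: e i = 0 ->
    forall i, c i = 0) -> forall c d : 'I_k -> F,
    \sum_i c i *: e i = \sum_i d i *: e i -> forall i, c i = d i.
  move=> efree c d cd i; apply/eqP; rewrite -subr_eq0; apply/eqP.
  apply: (efree (fun i => c i - d i)); rewrite -[RHS](subrr (\sum_i d i *: e i)).
  by rewrite -{1}cd -sumrB; apply: eq_bigr => j _; rewrite scalerBl.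
have ex i : exists c : 'I_m -> F, b' i = \sum_j c j *: b j by exact: bgen.
have ex' i : exists c : 'I_m' -> F, b i = \sum_j c j *: b' j by exact: bgen'.
have [p pE] := choice ex; have [p' pE'] := choice ex'.
pose P : 'M[F]_(m', m) := \matrix_(i, j) p i j.
pose P' : 'M[F]_(m, m') := \matrix_(i, j) p' i j.
have bP i : b' i = \sum_j P i j *: b j.
  by rewrite pE; apply: eq_bigr => j _; rewrite mxE.
have bP' i : b i = \sum_j P' i j *: b' j.
  by rewrite pE'; apply: eq_bigr => j _; rewrite mxE.
have mulE k l r (A : 'M[F]_(k, l)) (B : 'M[F]_(l, r)) (e : 'I_r -> V) i :
    \sum_j (A *m B) i j *: e j = \sum_j A i j *: \sum_h B j h *: e h.
  under [RHS]eq_bigr do rewrite scaler_sumr.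
  rewrite exchange_big /=; apply: eq_bigr => j _.
  by rewrite mxE scaler_suml; apply: eq_bigr => h _; rewrite scalerA.
have PP' : P *m P' = 1%:M.
  apply/matrixP => i; apply: (freeE _ b') => //; rewrite mulE.
  under eq_bigr do rewrite -bP'.
  rewrite -bP (bigD1 i) //= mxE eqxx scale1r big1 ?addr0 // => j ji.
  by rewrite mxE eq_sym (negPf ji) scale0r.
have P'P : P' *m P = 1%:M.
  apply/matrixP => i; apply: (freeE _ b) => //; rewrite mulE.
  under eq_bigr do rewrite -bP.
  rewrite -bP' (bigD1 i) //= mxE eqxx scale1r big1 ?addr0 // => j ji.
  by rewrite mxE eq_sym (negPf ji) scale0r.
have PM : P *m M = M' *m P.
  apply/matrixP => i; apply: (freeE _ b) => //; rewrite !mulE.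
  transitivity (\sum_j P i j *: f (b j)).
    by apply: eq_bigr => j _; rewrite -fb.
  transitivity (f (b' i)).
    by rewrite bP linear_sum; apply: eq_bigr => j _; rewrite linearZ.
  by rewrite fb'; apply: eq_bigr => j _; rewrite -bP.
by rewrite -[M']mulmx1 -PP' mulmxA -PM -mulmxA mxtrace_mulC -mulmxA P'P mulmx1.
Qed.

Lemma trace_onE W (f : {linear V -> V}) t : is_trace W f t -> trace_on W f = t.
Proof.
move=> ft; rewrite /trace_on; case: xgetP => [t' _ ft'|/(_ t)//].
exact: is_trace_uniq ft' ft.
Qed.
End Trace.

HB.instance Definition _ (F : fieldType) (n : nat) (s : signed_perm n) :=
  GRing.isLinear.Build F (coinv F n) (coinv F n) _ (@coinv_act F n s)
    (@coinv_act_linear F n s).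

(* The character of the representation of B_n on R_n^i, as a function on B_n. *)
Definition coinv_char (F : fieldType) (n i : nat) (s : signed_perm n) : F :=
  trace_on (coinv_graded (F := F) (n := n) i) (coinv_act s).

(* Main.v *)
(** The trace generating function of a signed permutation s on the polynomial
    ring S is 1 / det(1 - t s), i.e. the product over the cycles c of s of
    1 / (1 - sgn(c) t^|c|).  As a graded module over the ring of invariants,
    which is generated by the elementary symmetric polynomials e_1, ..., e_n in
    the squares, of degrees 2, 4, ..., 2n, S is free on the Artin monomials,
    those whose exponent of x_i is less than 2(i+1) (indices from 0), and the
    action of s is linear over the invariants.  Hence the trace generating
    function of s on the coinvariant algebra is that on S times the product of
    the 1 - t^(2k) for 1 <= k <= n.  Modulo t^(2n+2) this agrees with the
    product over all k >= 1, which is the series of the Q_i evaluated at s.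

    Freeness follows from spanning alone: to x^m one associates the Artin
    monomial of the exponents m_i mod 2(i+1), times the product of the
    e_(i+1)^(m_i div 2(i+1)), which has the same degree; so the number of these
    products in each degree is the dimension of S in that degree.  They span
    because h_(i+1)(x_i^2, ..., x_(n-1)^2) lies in the ideal of positive degree
    invariants and has leading monomial x_i^(2(i+1)).                          *)

Require Import Defs.
From HB Require Import structures.
From mathcomp Require Import all_boot all_order all_algebra all_fingroup.
From mathcomp Require Import boolp reals complex.
From mathcomp Require Import ssrcomplements mpoly zify ring.

Set Implicit Arguments.
Unset Strict Implicit.
Unset Printing Implicit Defensive.

Import GRing.Theory.
Local Open Scope ring_scope.

(** * Power series, the binomial series and the polynomials Q_i *)

Section FpsTheory.
Context {A : comNzRingType}.
Implicit Types (f g u : fps A) (a b : nat -> A).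

Lemma fcoefM f g n :
  fcoef (f * g) n = \sum_(j < n.+1) fcoef f j * fcoef g (n - j).
Proof. by []. Qed.

Lemma fcoef1 n : fcoef (1 : fps A) n = (n == 0)%:R.
Proof. by []. Qed.

Lemma fcoefM0 f g : fcoef (f * g) 0 = fcoef f 0 * fcoef g 0.
Proof. by rewrite fcoefM big_ord1. Qed.

Lemma fcoef_sum (I : Type) (r : seq I) (P : pred I) (E : I -> fps A) n :
  fcoef (\sum_(i <- r | P i) E i) n = \sum_(i <- r | P i) fcoef (E i) n.
Proof. by elim/big_rec2: _ => // i x f _ <-. Qed.

Lemma fcoefMn f m n : fcoef (f *+ m) n = fcoef f n *+ m.
Proof. by elim: m => // m IH; rewrite !mulrS -IH. Qed.

Definition ford_ge k f := forall j, (j < k)%N -> fcoef f j = 0.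

Lemma ford_geM k l f g : ford_ge k f -> ford_ge l g -> ford_ge (k + l) (f * g).
Proof.
move=> fk gl n ltn; rewrite fcoefM big1 // => -[j /= ltj] _.
have [/fk ->|lekj] := ltnP j k; first by rewrite mul0r.
by rewrite gl ?mulr0 //; lia.
Qed.

Lemma ford_geX k f j : ford_ge k f -> ford_ge (k * j) (f ^+ j).
Proof.
move=> fk; elim: j => [|j IH]; first by rewrite muln0.
by rewrite exprS mulnS; apply: ford_geM.
Qed.

Lemma fcoef_exp_gt u j n : ford_ge 1 u -> (n < j)%N -> fcoef (u ^+ j) n = 0.
Proof. by move=> /(ford_geX (j := j)); rewrite mul1n; apply. Qed.

Lemma fsubst_coef a u n N : ford_ge 1 u -> (n <= N)%N ->
  fcoef (fsubst a u) n = \sum_(j < N.+1) a j * fcoef (u ^+ j) n.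
Proof.
move=> u0 leN; rewrite /fsubst /=.
rewrite (big_ord_widen N.+1 (fun j => a j * fcoef (u ^+ j) n)) //.
rewrite big_mkcond; apply: eq_bigr => j _; case: ltnP => // ltj.
by rewrite fcoef_exp_gt // mulr0.
Qed.

Lemma fsubst0 a u : fcoef (fsubst a u) 0 = a 0.
Proof. by rewrite /fsubst /= big_ord1 mulr1. Qed.

(** After expansion into terms a_i b_j u^(i+j) the double sum is regrouped by k = i + j. Pairs with
    i + j > n drop out, since u^(i+j) has order above n. *)
Lemma fsubstM a b u : ford_ge 1 u ->
  fsubst a u * fsubst b u = fsubst (fcoef (Fps a * Fps b)) u.
Proof.
move=> u0; apply: fpsP => n.
pose E i j := a i * b j * fcoef (u ^+ (i + j)) n.
transitivity (\sum_(i < n.+1) \sum_(j < n.+1) E i j).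
  rewrite fcoefM.
  transitivity (\sum_(l < n.+1) \sum_(i < n.+1) \sum_(j < n.+1)
     a i * b j * (fcoef (u ^+ i) l * fcoef (u ^+ j) (n - l))).
    apply: eq_bigr => l _; have lel := leq_ord l.
    rewrite (@fsubst_coef a u l n) // (@fsubst_coef b u (n - l) n) ?leq_subr //.
    rewrite mulr_suml; apply: eq_bigr => i _; rewrite mulr_sumr.
    by apply: eq_bigr => j _; rewrite mulrACA.
  rewrite exchange_big; apply: eq_bigr => i _.
  rewrite exchange_big; apply: eq_bigr => j _.
  by rewrite -mulr_sumr /E exprD.
transitivity (\sum_(i < n.+1) \sum_(k < n.+1 | (i <= k)%N) E i (k - i)%N).
  apply: eq_bigr => -[i /= lti] _.
  rewrite -(big_mkord xpredT (E i)) (@big_cat_nat _ _ _ (n.+1 - i)) ?leq_subr //=.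
  rewrite [X in _ + X]big_nat_cond [X in _ + X]big1 ?addr0; last first.
    by move=> j ltj; rewrite /E fcoef_exp_gt ?mulr0 //; lia.
  rewrite -(big_mkord (fun k => (i <= k)%N) (fun k => E i (k - i)%N)) /=.
  rewrite [RHS](@big_cat_nat _ _ _ i) ?(ltnW lti) //=.
  rewrite [X in _ = X + _]big_nat_cond [X in _ = X + _]big1 ?add0r => [|k /= Hk].
    2: by exfalso; lia.
  rewrite -[RHS]/(\sum_(0 + i <= k < n.+1 | (i <= k)%N) E i (k - i)%N).
  rewrite big_addn big_nat_cond [RHS]big_nat_cond.
  by apply: eq_big => [k|k _]; [lia | rewrite addnK].
rewrite (exchange_big_dep predT) //=; apply: eq_bigr => k _.
rewrite [RHS]mulr_suml.
rewrite (big_ord_widen n.+1 (fun i => a i * b (k - i)%N * fcoef (u ^+ k) n)) //.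
apply: eq_big => [i|i lei]; first by rewrite ltnS.
by rewrite /E subnKC.
Qed.

Lemma eq_fsubst a b u : a =1 b -> fsubst a u = fsubst b u.
Proof. by move=> ab; apply: fpsP => n; apply: eq_bigr => j _; rewrite ab. Qed.

Lemma fsubst_delta0 u : fsubst (fun j => (j == 0)%:R) u = 1.
Proof.
apply: fpsP => n; rewrite /fsubst /= big_ord_recl /= mul1r big1 ?addr0 // => j _.
by rewrite mul0r.
Qed.

Lemma fsubst_affine (c : A) u n : ford_ge 1 u ->
  fcoef (fsubst (fun j => (j == 0)%:R + c * (j == 1)%:R) u) n
    = fcoef (1 : fps A) n + c * fcoef u n.
Proof.
(* The bound [n.+1] makes the terms j = 0 and j = 1 present even in degree 0. *)
move=> u0; rewrite (@fsubst_coef _ _ n n.+1) //.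
rewrite !big_ord_recl big1 => [|j _]; last by rewrite /= mulr0 addr0 mul0r.
by rewrite /= mulr0 !addr0 add0r mulr1 expr1 mul1r.
Qed.

Lemma finvP f : fcoef f 0 = 1 -> f * Defs.finv f = 1.
Proof.
move=> f0; have u0 : ford_ge 1 (1 - f).
  by move=> [|//] _ /=; rewrite f0 subrr.
have -> : f * Defs.finv f =
    fsubst (fun j => (j == 0)%:R - 1 * (j == 1)%:R) (1 - f) * Defs.finv f.
  congr (_ * _); apply: fpsP => n; under eq_fsubst do rewrite -mulNr.
  by rewrite fsubst_affine //= mulN1r opprD opprK addNKr.
rewrite fsubstM // -[RHS](fsubst_delta0 (1 - f)); apply: eq_fsubst => n.
rewrite fcoefM /=; under eq_bigr do rewrite mulr1 mul1r.
case: n => [|n]; first by rewrite big_ord1 subr0.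
by rewrite !big_ord_recl big1 /= ?subr0 ?add0r ?addr0 ?subrr.
Qed.

Definition fone_mod k f := forall j, (j < k)%N -> fcoef f j = (j == 0)%:R.

Lemma fone_modM_coef k f g i : fone_mod k f -> (i < k)%N ->
  fcoef (g * f) i = fcoef g i.
Proof.
move=> fk ltik; rewrite fcoefM big_ord_recr /= subnn fk ?mulr1; last by lia.
rewrite big1 ?add0r // => -[j /= ltj] _; rewrite fk; last by lia.
by rewrite subn_eq0 leqNgt ltj mulr0.
Qed.

Lemma fone_modM k f g : fone_mod k f -> fone_mod k g -> fone_mod k (f * g).
Proof. by move=> fk gk j ltj; rewrite (fone_modM_coef _ gk) ?fk. Qed.

(** The k-th factor cannot change coefficients below t^k, so coefficient i is settled once the
    factors up to k = i are in. *)
Lemma fprod_stable (F : nat -> fps A) i N :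
    (forall k, (0 < k)%N -> fone_mod k (F k)) -> (i < N)%N ->
  fcoef (\prod_(1 <= k < N) F k) i = fcoef (\prod_(1 <= k < i.+1) F k) i.
Proof.
move=> F1 /subnK <-; elim: (N - _)%N => // m IH.
rewrite addSn big_nat_recr; last by lia.
rewrite -[RHS]IH; apply: (@fone_modM_coef (m + i.+1)%N); last by lia.
by apply: F1; lia.
Qed.

Lemma ford_geN k f : ford_ge k f -> ford_ge k (- f).
Proof. by move=> fk j /fk /= ->; rewrite oppr0. Qed.

Lemma ford_geW k l f : (l <= k)%N -> ford_ge k f -> ford_ge l f.
Proof. by move=> lelk fk j ltj; apply: fk; lia. Qed.

Lemma fcoef_ftX k n : fcoef (ft ^+ k : fps A) n = (n == k)%:R.
Proof.
elim: k n => [|k IH] n; first by rewrite fcoef1.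
rewrite exprSr fcoefM; case: n => [|n].
  by rewrite big_ord1 /= mulr0.
rewrite big_ord_recr /= subnn mulr0 addr0 big_ord_recr /= subSnn mulr1 IH.
rewrite big1 ?add0r // => -[j /= ltj] _; rewrite -[_ == 1]/(_ == 1)%N.
by case: eqP => [|_]; rewrite ?mulr0 //; lia.
Qed.

Lemma ford_ge_ftX k : ford_ge k (ft ^+ k : fps A).
Proof. by move=> j ltj; rewrite fcoef_ftX ltn_eqF. Qed.

Lemma ford_ge_exp_sum k u a : (0 < k)%N -> a 0 = 1 -> ford_ge k u ->
  fone_mod k (fsubst a u).
Proof.
move=> k0 a0 uk j ltj; rewrite /fsubst /= big_ord_recl a0 mul1r expr0 fcoef1.
rewrite big1 ?addr0 // => i _; rewrite (@ford_geX k _ (lift ord0 i)) ?mulr0 //=.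
by rewrite /bump; nia.
Qed.

Lemma fsubst_binomial u x : ford_ge 1 u ->
  fsubst (fun j => 'C(x, j)%:R) u = (1 + u) ^+ x.
Proof.
move=> u0; apply: fpsP => n.
(* The range up to n + x contains both the truncation at n and the whole finite binomial expansion;
   the surplus binomials are zero. *)
rewrite (@fsubst_coef _ _ n (n + x)) ?leq_addr // exprDn fcoef_sum.
rewrite (big_ord_widen (n + x).+1
  (fun i => fcoef (1 ^+ (x - i) * u ^+ i *+ 'C(x, i)) n)); last by lia.
rewrite [RHS]big_mkcond; apply: eq_bigr => i _; rewrite ltnS.
case: leqP => [_|ltxi]; last by rewrite bin_small // mul0r.
by rewrite fcoefMn expr1n mul1r mulr_natl.
Qed.
End FpsTheory.

(** * Binomial series and the two forms of the k-th factor *)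

Section Binpow.
Context {A : comAlgType rat}.
Implicit Types (f u v : fps A) (a b : A).

Lemma binc0 a : binc a 0 = 1.
Proof. by rewrite /binc big_ord0 invr1 scale1r. Qed.

(** Together with [binc0] this recurrence determines [binc], because j + 1 can be cancelled by
    [natr_lregA]. *)
Lemma bincS a j : j.+1%:R * binc a j.+1 = (a - j%:R) * binc a j.
Proof.
rewrite /binc big_ord_recr /= -!scalerAr mulr_natl -(scaler_nat j.+1) scalerA.
rewrite [X in _ *: X]mulrC; congr (_ *: _).
have jf k : k`!%:R != 0 :> rat by rewrite Num.Theory.pnatr_eq0 -lt0n fact_gt0.
by rewrite factS natrM invfM mulrAC mulVf ?mul1r // Num.Theory.pnatr_eq0.
Qed.

Lemma natr_lregA j : injective (fun x : A => j.+1%:R * x).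
Proof.
apply: (@can_inj _ _ _ (fun x => (j.+1%:R^-1 : rat) *: x)) => x /=.
rewrite mulr_natl -scaler_nat scalerA mulVf ?scale1r //.
by rewrite Num.Theory.pnatr_eq0.
Qed.

(* Both sides satisfy c_(j+1) (j+1) = (a + b - j) c_j. *)
Lemma binc_vandermonde a b j :
  fcoef (Fps (binc a) * Fps (binc b)) j = binc (a + b) j.
Proof.
elim: j => [|j IH]; first by rewrite fcoefM0 /= !binc0 mulr1.
apply: (@natr_lregA j); rewrite /= bincS -IH !fcoefM /= !mulr_sumr.
pose l (i : nat) := i%:R * binc a i * binc b (j.+1 - i).
pose r (i : nat) := binc a i * ((j.+1 - i)%:R * binc b (j.+1 - i)).
transitivity (\sum_(i < j.+2) (l i + r i)).
  apply: eq_bigr => -[i /= lti] _.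
  rewrite /l /r [X in _ + X]mulrCA -mulrA -mulrDl -natrD.
  by congr (_%:R * _); lia.
have l0 : l 0 = 0 by rewrite /l !mul0r.
have rj : r j.+1 = 0 by rewrite /r subnn mul0r mulr0.
transitivity (\sum_(i < j.+1) (l i.+1 + r i)).
  by rewrite !big_split /= big_ord_recl l0 add0r [X in _ + X]big_ord_recr /= rj addr0.
apply: eq_bigr => -[i /= lti] _.
rewrite /l /r subSS bincS subSn // bincS.
have -> : (j%:R : A) = i%:R + (j - i)%:R by rewrite -natrD subnKC.
ring.
Qed.

Lemma fbinpowD u a b : ford_ge 1 u ->
  fbinpow u a * fbinpow u b = fbinpow u (a + b).
Proof.
by move=> u0; rewrite fsubstM //; apply: eq_fsubst => j; exact: binc_vandermonde.
Qed.

Lemma fbinpow1 u : ford_ge 1 u -> fbinpow u 1 = 1 + u.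
Proof.
move=> u0; apply: fpsP => n.
transitivity (fcoef (1 : fps A) n + 1 * fcoef u n); last by rewrite mul1r.
rewrite -fsubst_affine //; congr (fcoef _ n); apply: eq_fsubst => j.
rewrite mul1r; elim: j => [|j IH]; first by rewrite binc0 addr0.
apply: (@natr_lregA j); rewrite /= bincS IH.
by case: j {IH} => [|[|j]] /=; rewrite ?subr0 ?subrr ?addr0 ?add0r ?mulr1 ?mulr0 ?mul0r.
Qed.

Lemma fbinpow_one_mod k u a : (0 < k)%N -> ford_ge k u -> fone_mod k (fbinpow u a).
Proof. by move=> k0 uk; apply: (ford_ge_exp_sum k0 _ uk); rewrite binc0. Qed.

Lemma fcoef_fbinpowM0 u v a b : fcoef (fbinpow u a * fbinpow v b) 0 = 1.
Proof. by rewrite fcoefM0 (fsubst0 _ u) (fsubst0 _ v) (binc0 a) (binc0 b) mulr1. Qed.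

(** To be read with u = t^k, p and q the powers of 1 - u and 1 + u with exponents a and b, p' and q'
    those with exponents 1 - a and 1 - b, and w the inverse of pq. *)
Lemma frac_eq (K : comNzRingType) (u p p' q q' w : K) :
    p * q * w = 1 -> p' * p = 1 - u -> q' * q = 1 + u ->
  p' * q' = (1 - u * u) * w.
Proof.
move=> pqw pp qq; have -> : 1 - u * u = (1 - u) * (1 + u) by ring.
by rewrite -pp -qq -[LHS]mulr1 -pqw; ring.
Qed.

Lemma fbinpow_frac k a b : (0 < k)%N ->
  fbinpow (- ft ^+ k) (1 - a) * fbinpow (ft ^+ k) (1 - b)
  = (1 - ft ^+ (2 * k)) * Defs.finv (fbinpow (- ft ^+ k) a * fbinpow (ft ^+ k) b).
Proof.
move=> k0; have tk : ford_ge 1 (ft ^+ k : fps A).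
  exact: ford_geW (@ford_ge_ftX _ k).
have ntk := ford_geN tk; rewrite mul2n -addnn exprD.
move: (ft ^+ k) tk ntk => u tk ntk.
apply: frac_eq; first exact: finvP (fcoef_fbinpowM0 _ _ _ _).
  by have := fbinpowD (1 - a) a ntk; rewrite subrK fbinpow1.
by have := fbinpowD (1 - b) b tk; rewrite subrK fbinpow1.
Qed.

Lemma mul_finv_fbinpow f u v a b :
  f * Defs.finv (fbinpow u a * fbinpow v b) * (fbinpow u a * fbinpow v b) = f.
Proof.
by rewrite -mulrA [X in f * X]mulrC (finvP (fcoef_fbinpowM0 _ _ _ _)) mulr1.
Qed.
End Binpow.

Lemma factor_binE k : (0 < k)%N -> factor_bin k = factor_frac k.
Proof. exact: fbinpow_frac. Qed.

Lemma factor_bin_one_mod k : (0 < k)%N -> fone_mod k (factor_bin k).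
Proof.
move=> k0; have tk := @ford_ge_ftX charpoly k.
exact: (@fone_modM charpoly k _ _ (fbinpow_one_mod _ k0 (ford_geN tk))
  (fbinpow_one_mod _ k0 tk)).
Qed.

Lemma factor_frac_one_mod k : (0 < k)%N -> fone_mod k (factor_frac k).
Proof. by move=> k0; rewrite -factor_binE //; exact: factor_bin_one_mod. Qed.

Lemma Qpoly_stable i N : (i < N)%N ->
  fcoef (\prod_(1 <= k < N) factor_frac k) i = Qpoly i.
Proof. by move=> ltiN; rewrite (fprod_stable factor_frac_one_mod). Qed.

Lemma is_fprod_factor_frac : is_fprod factor_frac (Fps Qpoly).
Proof. by move=> i; exists i.+1 => N ltiN; exact: Qpoly_stable. Qed.

Lemma is_fprod_factor_bin : is_fprod factor_bin (Fps Qpoly).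
Proof.
move=> i; exists i.+1 => N ltiN.
have -> : \prod_(1 <= k < N) factor_bin k = \prod_(1 <= k < N) factor_frac k.
  by apply: eq_big_nat => k /andP[k0 _]; exact: factor_binE.
exact: Qpoly_stable ltiN.
Qed.

(** * Evaluation of power series at a signed permutation *)

Section FpsMap.
Context {A B : comNzRingType} (phi : {rmorphism A -> B}).

Definition fps_map (f : fps A) : fps B := Fps (fun n => phi (fcoef f n)).

Lemma fps_map_zmod_morphism : zmod_morphism fps_map.
Proof. by move=> f g; apply: fpsP => n /=; rewrite rmorphB. Qed.

Lemma fps_map_monoid_morphism : monoid_morphism fps_map.
Proof.
split=> [|f g]; apply: fpsP => n; first by rewrite /= rmorph_nat.
by rewrite fcoefM /= rmorph_sum; apply: eq_bigr => j _; rewrite rmorphM.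
Qed.

HB.instance Definition _ :=
  GRing.isZmodMorphism.Build (fps A) (fps B) fps_map fps_map_zmod_morphism.
HB.instance Definition _ :=
  GRing.isMonoidMorphism.Build (fps A) (fps B) fps_map fps_map_monoid_morphism.

Lemma fps_map_ft : fps_map ft = ft.
Proof. by apply: fpsP => n /=; rewrite rmorph_nat. Qed.

Lemma fps_map_subst a u : fps_map (fsubst a u) = fsubst (phi \o a) (fps_map u).
Proof.
apply: fpsP => n; rewrite /fsubst /= rmorph_sum; apply: eq_bigr => j _.
by rewrite rmorphM -rmorphXn.
Qed.
End FpsMap.

Section Evaluation.
Context {F : numFieldType} {n : nat} (s : signed_perm n).

Lemma charpoly_eval_zmod_morphism : zmod_morphism (charpoly_eval s).
Proof.
move=> P Q; have := charpoly_eval_linear s (-1) Q P.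
by rewrite scaleN1r mulN1r => e; rewrite addrC e addrC.
Qed.

HB.instance Definition _ := GRing.isZmodMorphism.Build charpoly rat
  (charpoly_eval s) charpoly_eval_zmod_morphism.
HB.instance Definition _ := GRing.isMonoidMorphism.Build charpoly rat
  (charpoly_eval s) (charpoly_eval_monoid_morphism s).

Definition evalF : charpoly -> F := ratr \o charpoly_eval s.
HB.instance Definition _ := GRing.RMorphism.copy evalF
  ((ratr : {rmorphism rat -> F}) \o charpoly_eval s).

(** The product of the x - m is the falling factorial, also for j > x, where both vanish. So at
    cycle counts the formal binomial powers become ordinary powers. *)
Lemma evalF_binc P x j : charpoly_eval s P = x%:R -> evalF (binc P j) = 'C(x, j)%:R.
Proof.
move=> Px.
have evZ c Q : charpoly_eval s (c *: Q) = c * charpoly_eval s Q.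
  by have := charpoly_eval_linear s c Q 0; rewrite addr0 raddf0 addr0.
rewrite /evalF /= evZ rmorph_prod /=.
under eq_bigr do rewrite rmorphB rmorph_nat /= Px.
have -> : \prod_(m < j) (x%:R - m%:R) = (x ^_ j)%:R :> rat.
  elim: j => [|j IH]; first by rewrite big_ord0.
  rewrite big_ord_recr /= IH ffactnSr natrM.
  have [lejx|ltxj] := leqP j x; first by rewrite natrB.
  by rewrite ffact_small // !mul0r.
rewrite -bin_ffact natrM mulrCA mulVf ?mulr1 ?ratr_nat //.
by rewrite Num.Theory.pnatr_eq0 -lt0n fact_gt0.
Qed.


Lemma fps_map_fbinpow u P x : ford_ge 1 u -> charpoly_eval s P = x%:R ->
  fps_map evalF (fbinpow u P) = (1 + fps_map evalF u) ^+ x.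
Proof.
move=> u0 Px; rewrite fps_map_subst -fsubst_binomial; last first.
  by move=> j ltj; rewrite /= u0 ?rmorph0.
by apply: eq_fsubst => j /=; exact: evalF_binc.
Qed.

Lemma evalF_factor_frac k : (0 < k)%N ->
  fps_map evalF (factor_frac k)
    * ((1 - ft ^+ k) ^+ ncycles s false k * (1 + ft ^+ k) ^+ ncycles s true k)
  = 1 - ft ^+ (2 * k).
Proof.
move=> k0; have tk : ford_ge 1 (ft ^+ k : fps charpoly).
  exact: ford_geW (@ford_ge_ftX _ k).
pose h : {rmorphism fps charpoly -> fps F} := fps_map evalF.
have mt j : h (ft ^+ j) = ft ^+ j by rewrite rmorphXn /= fps_map_ft.
have hN : h (- ft ^+ k) = - ft ^+ k by rewrite rmorphN mt.
have <- : h (fbinpow (- ft ^+ k) (Xvar k)) = (1 - ft ^+ k) ^+ ncycles s false k.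
  rewrite -hN; exact: fps_map_fbinpow (ford_geN tk) (charpoly_evalX s k).
have <- : h (fbinpow (ft ^+ k) (Yvar k)) = (1 + ft ^+ k) ^+ ncycles s true k.
  rewrite -mt; exact: fps_map_fbinpow tk (charpoly_evalY s k).
have /(congr1 h) := mul_finv_fbinpow (1 - ft ^+ (2 * k)) (- ft ^+ k) (ft ^+ k)
  (Xvar k) (Yvar k).
have -> : h (1 - ft ^+ (2 * k)) = 1 - ft ^+ (2 * k) by rewrite rmorphB rmorph1 mt.
move=> <-; apply: esym; apply: etrans (rmorphM h _ _) _.
by congr (_ * _); exact: (rmorphM h).
Qed.
End Evaluation.

(** * Trace series of weights on monomials *)

Section MonomialSeries.
Context {n : nat}.
Implicit Types (m v : 'X_{1..n}).

Lemma sum_bmnm_shift (V : nmodType) (G : 'X_{1..n} -> V) d v : (mdeg v <= d)%N ->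
  \sum_(m : 'X_{1..n < d.+1} | (mdeg m == d) && (v <= m)%MM) G m
  = \sum_(m : 'X_{1..n < (d - mdeg v).+1} | mdeg m == (d - mdeg v)%N) G (m + v)%MM.
Proof.
move=> levd; set e := (d - mdeg v)%N.
(* Translation by v and its inverse. The default 0 is never taken by [h], and by [h'] only on
   monomials not divisible by x^v. *)
pose h (m : 'X_{1..n < e.+1}) : 'X_{1..n < d.+1} := insubd (@bm0 n d) (m + v)%MM.
pose h' (m : 'X_{1..n < d.+1}) : 'X_{1..n < e.+1} := insubd (@bm0 n e) (m - v)%MM.
have hE (m : 'X_{1..n < e.+1}) : val (h m) = (m + v)%MM.
  by have := bmdeg m; rewrite val_insubd mdegD /e => ltm; rewrite ifT //; lia.
have h'E (m : 'X_{1..n < d.+1}) : (v <= m)%MM -> val (h' m) = (m - v)%MM.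
  move=> vm; have := bmdeg m; rewrite -{1}(submK vm) mdegD /e val_insubd => ltm.
  by rewrite ifT //; lia.
rewrite (reindex_onto h h') /= => [|m /andP[_ vm]]; last first.
  by apply: val_inj; rewrite hE h'E // submK.
apply: eq_big => [m|m _]; last by rewrite -[X in G X]/(val (h m)) hE.
rewrite -[X in mdeg X]/(val (h m)) -[X in (v <= X)%MM]/(val (h m)) hE lem_addl andbT.
rewrite mdegD; have -> : h' (h m) = m.
  by apply: val_inj; rewrite h'E; rewrite -[bmnm (h m)]/(val (h m)) hE ?addmK ?lem_addl.
rewrite eqxx andbT; apply/eqP/eqP; rewrite /e; lia.
Qed.

Context {F : comNzRingType}.
Implicit Types (w : 'X_{1..n} -> F).

(** When w lists the diagonal entries of a graded operator in a basis indexed by monomials, this is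
    its graded trace series. *)
Definition mseries w : fps F :=
  Fps (fun d => \sum_(m : 'X_{1..n < d.+1} | mdeg m == d) w m).

Lemma mseriesE w d :
  fcoef (mseries w) d = \sum_(m : 'X_{1..n < d.+1} | mdeg m == d) w m.
Proof. by []. Qed.

Lemma eq_mseries w w' : w =1 w' -> mseries w = mseries w'.
Proof. by move=> ww; apply: fpsP => d; apply: eq_bigr => m _; rewrite ww. Qed.

Lemma fcoef_ftXM (f : fps F) k d :
  fcoef (ft ^+ k * f) d = if (k <= d)%N then fcoef f (d - k) else 0.
Proof.
rewrite fcoefM; under eq_bigr do rewrite fcoef_ftX.
case: leqP => [lekd|ltdk].
  have ltk : (k < d.+1)%N by [].
  rewrite (bigD1 (Ordinal ltk)) //= eqxx mul1r big1 ?addr0 // => j.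
  by rewrite -val_eqE /= => /negPf ->; rewrite mul0r.
by rewrite big1 // => -[j /= ltj] _; rewrite ltn_eqF ?mul0r //; lia.
Qed.

(** The factor of det(1 - t s) coming from a cycle of length k, negative when b holds. *)
Definition fsign_binom (b : bool) k : fps F := 1 - (-1) ^+ b * ft ^+ k.

Lemma fcoef_fsign_binomM b k (f : fps F) d :
  fcoef (fsign_binom b k * f) d
  = fcoef f d - (-1) ^+ b * (if (k <= d)%N then fcoef f (d - k) else 0).
Proof.
rewrite /fsign_binom mulrBl mul1r -mulrA -fcoef_ftXM.
rewrite -[LHS]/(fcoef f d - fcoef ((-1) ^+ b * (ft ^+ k * f)) d); congr (_ - _).
by case: b; rewrite ?expr0 ?expr1 ?mul1r // !mulN1r.
Qed.

(** The multiples of x^v are the translates by v of all monomials, so they contribute (-1)^b t^|v|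
    times the whole series, which is what the factor subtracts. *)
Lemma mseries_shift w v (b : bool) :
    (forall m, w (m + v)%MM = (-1) ^+ b * w m) ->
  fsign_binom b (mdeg v) * mseries w
  = mseries (fun m => if (v <= m)%MM then 0 else w m).
Proof.
move=> wv; apply: fpsP => d; rewrite fcoef_fsign_binomM !mseriesE.
rewrite (bigID (fun m : 'X_{1..n < d.+1} => (v <= m)%MM)) /= addrAC.
rewrite -[RHS]add0r; congr (_ + _); last first.
  by rewrite big_mkcondr /=; apply: eq_bigr => m _; case: (v <= m)%MM.
apply/eqP; rewrite subr_eq0; apply/eqP; case: leqP => [levd|ltdv].
  rewrite sum_bmnm_shift // mulr_sumr.
  by apply: eq_bigr => m _; rewrite wv.
rewrite mulr0 big1 // => m /andP[/eqP dm vm]; exfalso.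
have := congr1 (@mdeg n) (submK vm); rewrite mdegD dm; lia.
Qed.

(** Sieving by one x^(v j) after another. A shift by one v j does not affect divisibility by
    another, so the weight left after some sieving still obeys the shift rule. Serves both for the
    cycles of s and for the generators of the invariants. *)
Lemma mseries_prod_shift (J : eqType) (L : seq J) (v : J -> 'X_{1..n})
    (b : J -> bool) w :
    uniq L ->
    {in L & predT, forall j m, w (m + v j)%MM = (-1) ^+ b j * w m} ->
    {in L &, forall i j, i != j -> forall m, (v i <= m + v j)%MM = (v i <= m)%MM} ->
  (\prod_(j <- L) fsign_binom (b j) (mdeg (v j))) * mseries w
  = mseries (fun m => if all (fun j => ~~ (v j <= m)%MM) L then w m else 0).
Proof.
elim: L => [|j L IH] /=; first by move=> _ _ _; rewrite big_nil mul1r; exact: eq_mseries.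
move=> /andP[jL uL] wv dis; rewrite big_cons -mulrA IH //; last 2 first.
- by move=> i m iL _; rewrite wv // inE iL orbT.
- by move=> i k iL kL; apply: dis; rewrite inE ?iL ?kL orbT.
rewrite mseries_shift => [|m].
  by apply: eq_mseries => m; case: (v j <= m)%MM.
rewrite wv ?mem_head // (_ : all _ L = all (fun i => ~~ (v i <= m)%MM) L).
  by case: ifP; rewrite ?mulr0.
apply: eq_in_all => i iL; congr (~~ _); apply: dis; rewrite ?mem_head //.
  by rewrite inE iL orbT.
by apply: contraNneq jL => <-.
Qed.
End MonomialSeries.

(** * The trace series of a signed permutation on polynomials *)

Section TraceSeries.
Context {F : fieldType} {n : nat} (s : signed_perm n).
Local Notation S := {mpoly F[n]}.

Lemma sp_act_mpolyX (m : 'X_{1..n}) :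
  sp_act s ('X_[m] : S)
  = (-1) ^+ (\sum_i (sp_neg s i * m i))%N
    *: 'X_[[multinom m ((sp_perm s)^-1%g i) | i < n]].
Proof.
rewrite /sp_act comp_mpolyX.
rewrite (eq_bigr (fun i => (-1) ^+ (sp_neg s i * m i)
    *: ('X_(sp_perm s i) ^+ m i : S))); last first.
  by move=> i _; rewrite tnth_mktuple exprZn -exprM.
rewrite scaler_prod; congr (_ *: _); first by rewrite -expr_sum.
rewrite [RHS]mpolyXE_id [RHS](reindex_inj (@perm_inj _ (sp_perm s))) /=.
by apply: eq_bigr => i _; rewrite mnmE permK.
Qed.

(** The variables of a cycle are permuted among themselves, so their product only picks up the sign
    of the cycle. *)
Lemma sp_act_mesym1 (c : {set 'I_n}) : c \in porbits (sp_perm s) ->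
  sp_act s ('X_[mesym1 c] : S) = (-1) ^+ cycle_neg s c *: 'X_[mesym1 c].
Proof.
move=> /imsetP[i0 _ ->]; set c' := porbit _ _.
have XE : 'X_[mesym1 c'] = \prod_(i in c') 'X_i :> S.
  rewrite mpolyXE_id [RHS]big_mkcond; apply: eq_bigr => i _.
  by rewrite mnmE; case: (i \in c').
rewrite XE rmorph_prod /=; under eq_bigr do rewrite sp_actX.
rewrite scaler_prod; congr (_ *: _).
  rewrite /cycle_neg; elim/big_rec2: _ => // i b x _ ->.
  by rewrite signr_addb.
rewrite [RHS](reindex_inj (@perm_inj _ (sp_perm s))) /=.
apply: eq_bigl => i; rewrite /c' -!eq_porbit_mem.
by have := porbit_perm (sp_perm s) 1 i; rewrite expg1 => ->.
Qed.

Definition diag_weight (m : 'X_{1..n}) : F := (sp_act s ('X_[m] : S))@_m.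

Lemma diag_weight_shift m c : c \in porbits (sp_perm s) ->
  diag_weight (m + mesym1 c)%MM = (-1) ^+ cycle_neg s c * diag_weight m.
Proof.
move=> cs; rewrite /diag_weight mpolyXD rmorphM /= sp_act_mesym1 //.
by rewrite -scalerAr mcoeffZ addmC mcoeffMX.
Qed.

Lemma diag_weight_fixed m : diag_weight m != 0 -> forall i, m (sp_perm s i) = m i.
Proof.
rewrite /diag_weight sp_act_mpolyX mcoeffZ mcoeffX.
case: (_ =P m) => [mE _ i|_]; last by rewrite /= mulr0 eqxx.
by rewrite -{1}mE mnmE permK.
Qed.

Lemma diag_weight_orbit m i j : diag_weight m != 0 ->
  j \in porbit (sp_perm s) i -> m j = m i.
Proof.
move=> wm /porbitP[k ->]; elim: k => [|k IH]; first by rewrite perm1.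
by rewrite expgSr permM diag_weight_fixed.
Qed.

(** This gives 1 / det(1 - t s) without diagonalising: sieving out the multiples of the cycle
    products leaves only m = 0, because a monomial of nonzero weight has constant exponents on each
    cycle. *)
Lemma mseries_diag_weight :
  (\prod_(c <- enum (porbits (sp_perm s))) fsign_binom (cycle_neg s c) #|c|)
    * mseries diag_weight = 1.
Proof.
under eq_bigr do rewrite -mdeg_mesym1.
rewrite mseries_prod_shift ?enum_uniq //; last 2 first.
- by move=> c m; rewrite mem_enum => cs _; exact: diag_weight_shift.
- move=> c d; rewrite !mem_enum => cs ds cd m.
  have dis i : i \in c -> i \in d -> false.
    move=> ic id; move: cs ds cd => /imsetP[x _ cE] /imsetP[y _ dE].
    by move: ic id; rewrite cE dE -!eq_porbit_mem => /eqP -> /eqP ->; rewrite eqxx.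
  apply/mnm_lepP/mnm_lepP => h i; have := h i; rewrite !(mnmDE, mnmE).
    case ic: (i \in c) => //; case id: (i \in d); last by rewrite addn0.
    by have := dis i ic id.
  by move=> h1; apply: leq_trans h1 (leq_addr _ _).
apply: fpsP => d; rewrite mseriesE fcoef1.
have w0 (m : 'X_{1..n}) : (if all (fun c => ~~ (mesym1 c <= m)%MM)
      (enum (porbits (sp_perm s))) then diag_weight m else 0) = (m == 0%MM)%:R.
  case: eqP => [->|/eqP m0].
    rewrite ifT; last first.
      apply/allP => c; rewrite mem_enum => /imsetP[i _ ->].
      apply/negP => /mnm_lepP /(_ i); rewrite mnm0E mnmE.
      by rewrite porbit_id.
    by rewrite /diag_weight mpolyX0 rmorph1 mcoeff1 eqxx.
  case: allP => // h; apply: contraTeq isT => wm.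
  have [i mi] : exists i, m i != 0%N.
    apply/existsP; apply: contraNT m0; rewrite negb_exists => /forallP m0.
    by apply/eqP/mnmP => i; rewrite mnm0E; apply/eqP; rewrite -[_ == _]negbK m0.
  have orb_i : porbit (sp_perm s) i \in enum (porbits (sp_perm s)).
    by rewrite mem_enum imset_f.
  (* The exponent is positive at i, hence on its whole orbit, so the product of that orbit divides
     x^m. *)
  move: (h _ orb_i); apply: contraNT => _; apply/mnm_lepP => j.
  rewrite mnmE; case ji: (j \in _) => //.
  by rewrite (diag_weight_orbit wm ji) lt0n.
under eq_bigr do rewrite w0.
case: d => [|d].
  rewrite (bigD1 (@bm0 n 0)) ?mdeg0 //= eqxx big1 ?addr0 // => m /andP[_].
  by rewrite -val_eqE /= => /negPf ->.
rewrite big1 // => m /eqP dm; case: eqP => // m0.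
by move: dm; rewrite m0 mdeg0.
Qed.

Lemma prod_ncycles N : (n < N)%N ->
  \prod_(1 <= k < N) ((1 - ft ^+ k) ^+ ncycles s false k
                        * (1 + ft ^+ k) ^+ ncycles s true k)
  = \prod_(c <- enum (porbits (sp_perm s))) fsign_binom (cycle_neg s c) #|c|
  :> fps F.
Proof.
move=> ltnN; rewrite big_enum /=.
have szc c : c \in porbits (sp_perm s) -> (0 < #|c| < N)%N.
  move=> /imsetP[i _ ->]; rewrite card_gt0; apply/andP; split.
    by apply/set0Pn; exists i; exact: porbit_id.
  by rewrite (leq_ltn_trans (max_card _)) ?card_ord.
(* Cycles are sorted by length, then by sign; N > n leaves no cycle length out. *)
transitivity (\prod_(1 <= k < N) \prod_(c in porbits (sp_perm s))
    (if #|c| == k then fsign_binom (cycle_neg s c) k else 1 : fps F)).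
  rewrite big_nat [RHS]big_nat; apply: eq_bigr => k _.
  rewrite -big_mkcondr (bigID (cycle_neg s)) /= mulrC.
  have fE b : \prod_(c in porbits (sp_perm s) | (#|c| == k) && (cycle_neg s c == b))
      fsign_binom (cycle_neg s c) k = fsign_binom b k ^+ ncycles s b k :> fps F.
    rewrite /ncycles -sum1_card expr_sum; apply: eq_big => c.
      by rewrite inE.
    by move=> /and3P[_ _ /eqP ->]; rewrite expr1.
  have := fE true; have := fE false; rewrite /fsign_binom expr0 expr1 mul1r mulN1r opprK.
  move=> <- <-; rewrite -/fsign_binom; congr (_ * _); apply: eq_bigl => c;
    by rewrite -andbA; case: (cycle_neg s c).
rewrite exchange_big /=; apply: eq_bigr => c /szc szN.
rewrite (bigD1_seq #|c|) ?iota_uniq ?mem_index_iota //= eqxx.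
rewrite big1 ?mulr1 // => k; by rewrite eq_sym => /negPf ->.
Qed.
End TraceSeries.

(** * Invariants of the hyperoctahedral group *)

Section LinearExtension.
Context {F : fieldType} {n : nat} {V : lmodType F} (B : 'X_{1..n} -> V).
Local Notation S := {mpoly F[n]}.

Definition lin_ext (p : S) : V := \sum_(m <- msupp p) p@_m *: B m.

Lemma lin_extwE k p : (msize p <= k)%N ->
  lin_ext p = \sum_(m : 'X_{1..n < k}) p@_m *: B m.
Proof.
move=> le_pk; rewrite /lin_ext (big_mksub 'X_{1..n < k}) /=; first last.
- by move=> m /msize_mdeg_lt /leq_trans; apply.
- exact: msupp_uniq.
by rewrite big_rmcond //= => m /memN_msupp_eq0 ->; rewrite scale0r.
Qed.

Lemma lin_ext_is_linear : linear lin_ext.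
Proof.
move=> c p q; pose k := maxn (msize (c *: p + q)) (maxn (msize p) (msize q)).
rewrite (@lin_extwE k (c *: p + q)) ?leq_maxl // (@lin_extwE k p); last by lia.
rewrite (@lin_extwE k q); last by lia.
rewrite scaler_sumr -big_split; apply: eq_bigr => m _ /=.
by rewrite linearP scalerDl scalerA.
Qed.

HB.instance Definition _ :=
  GRing.isLinear.Build F S V _ lin_ext lin_ext_is_linear.

Lemma lin_extX m : lin_ext 'X_[m] = B m.
Proof. by rewrite /lin_ext msuppX big_seq1 mcoeffX eqxx scale1r. Qed.
End LinearExtension.

Lemma eq_linear_mpolyX (F : fieldType) n (V : lmodType F)
    (f g : {linear mpoly n F -> V}) :
  (forall m, f 'X_[m] = g 'X_[m]) -> f =1 g.
Proof.
move=> fg p; rewrite [p]mpolyE !linear_sum; apply: eq_bigr => m _.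
by rewrite !linearZ /= fg.
Qed.

Lemma mcoeff_sum (R : nzRingType) n (I : Type) (r : seq I) (P : pred I)
    (E : I -> mpoly n R) m :
  (\sum_(i <- r | P i) E i)@_m = \sum_(i <- r | P i) (E i)@_m.
Proof. exact: (raddf_sum (mcoeff m)). Qed.

Section Squares.
Context {F : fieldType} {n : nat}.
Local Notation S := {mpoly F[n]}.

Definition sqvars : n.-tuple S := [tuple 'X_i ^+ 2 | i < n].

Lemma comp_sqvarsX m : 'X_[m] \mPo sqvars = 'X_[m *+ 2].
Proof.
rewrite comp_mpolyX [RHS]mpolyXE_id; apply: eq_bigr => i _.
by rewrite tnth_mktuple -exprM mulmnE mulnC.
Qed.

Lemma mulmn2_inj : injective (fun m : 'X_{1..n} => m *+ 2)%MM.
Proof.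
move=> m1 m2 /mnmP e; apply/mnmP => i; have := e i.
by rewrite !mulmnE; lia.
Qed.

Lemma mcoeff_comp_sqvars (g : S) m : (g \mPo sqvars)@_(m *+ 2) = g@_m.
Proof.
rewrite [g in LHS]mpolyE [g in RHS]mpolyE (linear_sum (comp_mpoly sqvars)).
rewrite !mcoeff_sum; apply: eq_bigr => k _.
by rewrite !linearZ /= comp_sqvarsX !mcoeffX (inj_eq mulmn2_inj).
Qed.

(** Signs disappear on squares, so only the underlying permutation acts. *)
Lemma sp_act_comp_sqvars s (g : S) :
  sp_act s (g \mPo sqvars) = msym (sp_perm s) g \mPo sqvars.
Proof.
pose f1 : {linear mpoly n F -> mpoly n F} := sp_act s \o comp_mpoly sqvars.
pose f2 : {linear mpoly n F -> mpoly n F} := comp_mpoly sqvars \o msym (sp_perm s).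
apply: (@eq_linear_mpolyX _ _ _ f1 f2) => m; rewrite /f1 /f2 /=.
rewrite msymX 2!comp_sqvarsX sp_act_mpolyX.
have -> : (\sum_i (sp_neg s i * (m *+ 2)%MM i) = 2 * \sum_i (sp_neg s i * m i))%N.
  by rewrite big_distrr; apply: eq_bigr => i _; rewrite mulmnE /=; lia.
rewrite exprM sqrrN expr1n expr1n scale1r; congr 'X_[_].
by apply/mnmP => i; rewrite !(mnmE, mulmnE).
Qed.

Lemma comp_sqvars_invariant (g : S) : g \is symmetric ->
  sp_invariant (g \mPo sqvars).
Proof. by move=> /issymP gsym s; rewrite sp_act_comp_sqvars gsym. Qed.

Lemma sp_act_mcoeff s (f : S) m :
  (sp_act s f)@_m
  = (-1) ^+ (\sum_i (sp_neg s i * m (sp_perm s i)))%N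
    * f@_[multinom m (sp_perm s i) | i < n].
Proof.
rewrite [f in LHS]mpolyE [f in RHS]mpolyE (linear_sum (sp_act s)).
rewrite !mcoeff_sum mulr_sumr.
apply: eq_bigr => k _; rewrite !linearZ /= sp_act_mpolyX mcoeffZ !mcoeffX mulrCA.
have -> : ([multinom k ((sp_perm s)^-1%g i) | i < n] == m)
    = (k == [multinom m (sp_perm s i) | i < n]).
  apply/eqP/eqP => [<-|->]; apply/mnmP => i; rewrite !mnmE ?permK ?permKV //.
case: (k =P _) => [->|_]; last by rewrite !mulr0.
by congr (_ ^+ _ * _); apply: eq_bigr => i _; rewrite mnmE.
Qed.

Context (two_neq0 : 2%:R != 0 :> F).

(** Flipping the sign of x_i alone negates this coefficient. *)
Lemma sp_invariant_even (f : S) (m : 'X_{1..n}) i :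
  sp_invariant f -> odd (m i) -> f@_m = 0.
Proof.
move=> inv_f odd_mi; pose s := SignedPerm 1%g [ffun j => j == i].
have := sp_act_mcoeff s f m; rewrite inv_f.
have -> : [multinom m (sp_perm s j) | j < n] = m.
  by apply/mnmP => j; rewrite mnmE perm1.
have -> : (\sum_j (sp_neg s j * m (sp_perm s j)) = m i)%N.
  rewrite (bigD1 i) //= ffunE eqxx mul1n perm1 big1 ?addn0 // => j /negPf ji.
  by rewrite ffunE ji.
rewrite -signr_odd odd_mi expr1 mulN1r => /eqP.
by rewrite -subr_eq0 opprK -mulr2n -mulr_natl mulf_eq0 (negPf two_neq0) => /eqP.
Qed.

(** All exponents of f are even and can be halved to give g. Substituting squares keeps
    coefficients, so invariance of f under unsigned permutations makes g symmetric. *)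
Lemma sp_invariant_sqvars (f : S) : sp_invariant f ->
  exists2 g : S, g \is symmetric & f = g \mPo sqvars.
Proof.
move=> inv_f; pose g : S := lin_ext (fun m => 'X_[[multinom (m i)./2 | i < n]] : S) f.
have fE : f = g \mPo sqvars.
  rewrite {1}[f]mpolyE /g /lin_ext (linear_sum (comp_mpoly sqvars)) big_seq [RHS]big_seq.
  apply: eq_bigr => m mf; rewrite linearZ /= comp_sqvarsX; congr (_ *: 'X_[_]).
  apply/mnmP => i; rewrite mulmnE mnmE; case odd_mi: (odd (m i)).
    by move: mf; rewrite mcoeff_msupp (sp_invariant_even inv_f odd_mi) eqxx.
  by rewrite muln2 -[LHS]odd_double_half odd_mi.
exists g => //; apply/issymP => s; apply/mpolyP => m.
rewrite -mcoeff_comp_sqvars -[RHS]mcoeff_comp_sqvars -fE.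
pose sp := SignedPerm s [ffun => false].
by rewrite -[s]/(sp_perm sp) -sp_act_comp_sqvars -fE inv_f.
Qed.

Lemma comp_sqvars_dhomog (g : S) d : g \is d.-homog ->
  g \mPo sqvars \is (2 * d).-homog.
Proof.
move=> hg; rewrite [g]mpolyE (linear_sum (comp_mpoly sqvars)) big_seq.
rewrite rpred_sum //= => m mg.
rewrite linearZ rpredZ //= comp_sqvarsX dhomogX /= mdegMn mulnC.
by rewrite -(dhomogP _ _ _ hg m mg).
Qed.
End Squares.

Section InvariantMonomials.
Context {F : fieldType} {n : nat}.
Local Notation S := {mpoly F[n]}.

Definition esq : n.-tuple S := [tuple mesym n F i.+1 \mPo sqvars | i < n].

Definition emon (v : 'X_{1..n}) : S := 'X_[v] \mPo esq.

(* The monomial with the same degree as [emon v] in which the i-th generator,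
   of degree 2(i+1), is replaced by the power of x_i of that degree. *)
Definition wmon (v : 'X_{1..n}) : 'X_{1..n} := [multinom (2 * i.+1 * v i)%N | i < n].

Lemma emonD v v' : emon (v + v') = emon v * emon v'.
Proof. by rewrite /emon mpolyXD rmorphM. Qed.

Lemma emon0 : emon 0 = 1.
Proof. by rewrite /emon mpolyX0 rmorph1. Qed.

Lemma esq_invariant i : sp_invariant (tnth esq i).
Proof.
by rewrite tnth_mktuple; apply: comp_sqvars_invariant; exact: mesym_sym.
Qed.

Lemma emon_invariant v : sp_invariant (emon v).
Proof.
move=> s; rewrite /emon comp_mpolyX rmorph_prod; apply: eq_bigr => i _.
by rewrite rmorphXn /= esq_invariant.
Qed.

Lemma emon_dhomog v : emon v \is (mdeg (wmon v)).-homog.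
Proof.
rewrite /emon comp_mpolyX mdegE.
elim/big_rec2: _ => [|i d q _ hq]; first exact: dhomog1.
rewrite mnmE; apply: dhomogM => //; rewrite tnth_mktuple.
apply: dhomogMn; apply: comp_sqvars_dhomog; exact: dhomog_mesym.
Qed.

Lemma mdeg_wmon_eq0 v : (mdeg (wmon v) == 0)%N = (v == 0%MM).
Proof.
rewrite mdeg_eq0; apply/eqP/eqP => [|->]; last first.
  by apply/mnmP => i; rewrite mnmE mnm0E muln0.
move=> /mnmP w0; apply/mnmP => i; have := w0 i; rewrite mnmE !mnm0E.
by lia.
Qed.

Context (two_neq0 : 2%:R != 0 :> F).

Lemma sp_invariant_emon (f : S) : sp_invariant f -> exists t : S, f = t \mPo esq.
Proof.
move=> /(sp_invariant_sqvars two_neq0)[g /sym_fundamental[t [<- _]] ->]; exists t.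
pose f1 : {linear mpoly n F -> mpoly n F} :=
  comp_mpoly sqvars \o comp_mpoly [tuple mesym n F i.+1 | i < n].
apply: (@eq_linear_mpolyX _ _ _ f1 (comp_mpoly esq)) => m; rewrite /f1 /=.
rewrite !comp_mpolyX rmorph_prod; apply: eq_bigr => i _.
by rewrite rmorphXn /= !tnth_mktuple.
Qed.

Lemma comp_esqE (t : S) : t \mPo esq = \sum_(v <- msupp t) t@_v *: emon v.
Proof. by rewrite comp_mpolyEX. Qed.

(** Every nontrivial monomial in the generators has positive degree. So an invariant without
    constant term is a combination of the [emon v] with v nonzero. *)
Lemma mcoeff0_comp_esq (t : S) : (t \mPo esq)@_0 = t@_0.
Proof.
rewrite comp_esqE [t in RHS]mpolyE !mcoeff_sum; apply: eq_bigr => v _.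
rewrite !mcoeffZ mcoeffX; congr (_ * _); case: eqP => [->|/eqP v0].
  by rewrite emon0 mcoeff1 eqxx.
by rewrite (dhomog_nemf_coeff (emon_dhomog v)) //= mdeg0 eq_sym mdeg_wmon_eq0.
Qed.
End InvariantMonomials.

(** * Freeness over the invariants *)

Section ArtinBasis.
Context {F : fieldType} {n : nat}.
Local Notation S := {mpoly F[n]}.

Definition artin_rem (m : 'X_{1..n}) : 'X_{1..n} :=
  [multinom (m i %% (2 * i.+1))%N | i < n].
Definition artin_quo (m : 'X_{1..n}) : 'X_{1..n} :=
  [multinom (m i %/ (2 * i.+1))%N | i < n].
Definition artin (m : 'X_{1..n}) := [forall i : 'I_n, (m i < 2 * i.+1)%N].

Definition artin_basis (m : 'X_{1..n}) : S := 'X_[artin_rem m] * emon (artin_quo m).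

Lemma artin_divE m : (artin_rem m + wmon (artin_quo m))%MM = m.
Proof. by apply/mnmP => i; rewrite mnmDE !mnmE addnC mulnC -divn_eq. Qed.

Lemma artin_basis_dhomog m : artin_basis m \is (mdeg m).-homog.
Proof.
rewrite -[m in mdeg m]artin_divE mdegD; apply: dhomogM (emon_dhomog _).
by rewrite dhomogX.
Qed.

(** Multiplying by the invariant [emon v] only shifts the index, as x^(wmon v) does for monomials;
    through this [Phi] transports the module structure. *)
Lemma artin_basis_wmon v m :
  artin_basis (wmon v + m)%MM = emon v * artin_basis m.
Proof.
rewrite /artin_basis mulrCA -emonD; congr ('X_[_] * emon _); apply/mnmP => i.
  by rewrite !mnmE mulnC modnMDl.
by rewrite mnmDE !mnmE mulnC divnMDl.
Qed.

Lemma artin_basis_artin m : artin m -> artin_basis m = 'X_[m].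
Proof.
move=> /forallP art; rewrite /artin_basis.
have -> : artin_quo m = 0%MM by apply/mnmP => i; rewrite mnmE mnm0E divn_small.
rewrite emon0 mulr1; congr 'X_[_]; apply/mnmP => i.
by rewrite mnmE modn_small.
Qed.

(** Bijectivity of this degree-preserving map expresses that S is free over the invariants on the
    Artin monomials. *)
Definition Phi : S -> S := lin_ext artin_basis.
HB.instance Definition _ := GRing.Linear.copy Phi (lin_ext artin_basis).

Lemma PhiX m : Phi 'X_[m] = artin_basis m.
Proof. exact: lin_extX. Qed.

Lemma Phi_wmon v p : Phi ('X_[wmon v] * p) = emon v * Phi p.
Proof.
rewrite [p]mpolyE mulr_sumr !(raddf_sum Phi) mulr_sumr; apply: eq_bigr => m _ /=.
by rewrite -scalerAr !linearZ /= -scalerAr -mpolyXD !PhiX artin_basis_wmon.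
Qed.

Lemma Phi_pihomog d p : Phi (pihomog mdeg d p) = pihomog mdeg d (Phi p).
Proof.
pose f1 : {linear mpoly n F -> mpoly n F} := Phi \o pihomog mdeg d.
pose f2 : {linear mpoly n F -> mpoly n F} := pihomog mdeg d \o Phi.
apply: (@eq_linear_mpolyX _ _ _ f1 f2) => m; rewrite /f1 /f2 /= pihomogX PhiX.
have hm := artin_basis_dhomog m.
case: eqP => [<-|/eqP dm]; first by rewrite PhiX pihomog_dE.
by rewrite raddf0 (pihomog_ne0 _ hm).
Qed.

Lemma Phi_comp_esq t p : exists q, (t \mPo esq) * Phi p = Phi q.
Proof.
exists ((\sum_(v <- msupp t) t@_v *: 'X_[wmon v]) * p).
rewrite comp_esqE !mulr_suml raddf_sum; apply: eq_bigr => v _ /=.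
by rewrite -!scalerAl linearZ /= Phi_wmon.
Qed.

Definition supp_ge (i : nat) (b : 'X_{1..n}) :=
  [forall j : 'I_n, (j < i)%N ==> (b j == 0)%N].

(* The complete homogeneous polynomial of degree k in the squares of the
   variables of index at least i. *)
Definition hsq (k i : nat) : S :=
  \sum_(b : 'X_{1..n < k.+1} | mdeg b == k) (if supp_ge i b then 'X_[b *+ 2] else 0).

Lemma hsq0_invariant k : sp_invariant (hsq k 0).
Proof.
pose g : S := \sum_(b : 'X_{1..n < k.+1}) (mdeg b == k)%:R *: 'X_[b].
have -> : hsq k 0 = g \mPo sqvars.
  rewrite (linear_sum (comp_mpoly sqvars)) /hsq big_mkcond; apply: eq_bigr => b _.
  have -> : supp_ge 0 b by apply/forallP => j; rewrite ltn0.
  rewrite linearZ /= comp_sqvarsX.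
  by case: (_ == k); rewrite ?scale1r ?scale0r.
apply: comp_sqvars_invariant; apply/issymP => s; apply/mpolyP => m.
have gE m' : g@_m' = (mdeg m' == k)%:R.
  have [ltm|lem] := ltnP (mdeg m') k.+1.
    exact: (mcoeff_mpoly (fun b => (mdeg b == k)%:R)).
  rewrite mcoeff_sum big1 => [|b _]; last first.
    rewrite mcoeffZ mcoeffX; case: (bmnm b =P m') => [e|]; rewrite ?mulr0 //.
    by exfalso; have := bmdeg b; rewrite e; lia.
  by rewrite gtn_eqF.
by rewrite mcoeff_sym !gE mdeg_mperm.
Qed.

(** The monomials of [hsq k.+1 i] are sorted by whether x_i occurs; where it does, one factor x_i^2
    comes out. *)
Lemma hsq_rec k (i : 'I_n) : hsq k.+1 i.+1 = hsq k.+1 i - 'X_i ^+ 2 * hsq k i.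
Proof.
apply/eqP; rewrite eq_sym subr_eq; apply/eqP.
rewrite [LHS]/hsq (bigID (fun b : 'X_{1..n < k.+2} => (U_(i) <= b)%MM)) /=.
have d1 : (mdeg (U_(i) : 'X_{1..n}) <= k.+1)%N by rewrite mdeg1.
rewrite (sum_bmnm_shift (fun b => if supp_ge i b then 'X_[b *+ 2] : S else 0) d1).
rewrite addrC; congr (_ + _).
  rewrite /hsq big_mkcondr; apply: eq_bigr => b _ /=.
  rewrite lep1mP negbK.
  have -> : supp_ge i.+1 b = (b i == 0%N) && supp_ge i b.
    apply/forallP/andP => [h|[b0 /forallP h] j].
      split; first by have := h i; rewrite ltnSn.
      by apply/forallP => j; apply/implyP => ltj; have := h j; rewrite ltnS ltnW.
    apply/implyP; rewrite ltnS leq_eqVlt => /orP[/eqP e|ltj].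
      by rewrite (val_inj e).
    by have := h j; rewrite ltj.
  by case: (_ == _).
have -> : (k.+1 - mdeg (U_(i) : 'X_{1..n}) = k)%N by rewrite mdeg1 subSS subn0.
rewrite /hsq mulr_sumr; apply: eq_bigr => b _.
have -> : supp_ge i (b + U_(i))%MM = supp_ge i b.
  apply: eq_forallb => j; case: ltnP => //= ltj; rewrite mnmDE mnm1E.
  by rewrite -[i == j]val_eqE /= (gtn_eqF ltj) addn0.
case: ifP; rewrite ?mulr0 // => _; rewrite mpolyXn -mpolyXD; congr 'X_[_].
by apply/mnmP => j; rewrite !(mulmnE, mnmDE, mnm1E); lia.
Qed.

Context (two_neq0 : 2%:R != 0 :> F).

Definition in_Phi (p : S) := exists q, Phi q = p.

Lemma in_Phi_linear a p q : in_Phi p -> in_Phi q -> in_Phi (a *: p + q).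
Proof. by move=> [p' <-] [q' <-]; exists (a *: p' + q'); rewrite linearP. Qed.

Lemma in_Phi0 : in_Phi 0.
Proof. by exists 0; rewrite raddf0. Qed.

Lemma in_PhiB p q : in_Phi p -> in_Phi q -> in_Phi (p - q).
Proof. by move=> [p' <-] [q' <-]; exists (p' - q'); rewrite raddfB. Qed.

Lemma in_Phi_sum (I : Type) (r : seq I) (P : pred I) (E : I -> S) :
  (forall i, P i -> in_Phi (E i)) -> in_Phi (\sum_(i <- r | P i) E i).
Proof.
move=> h; elim/big_rec: _ => [|i p Pi hp]; first exact: in_Phi0.
by rewrite -[E i]scale1r; apply: in_Phi_linear (h i Pi) hp.
Qed.

Lemma in_Phi_invariant f p : sp_invariant f -> in_Phi p -> in_Phi (p * f).
Proof.
move=> /(sp_invariant_emon two_neq0)[t ->] [q <-].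
by have [r rE] := Phi_comp_esq t q; exists r; rewrite -rE mulrC.
Qed.

(* By [hsq_rec] and the invariance of [hsq k 0], [hsq k i] lies in the ideal of
   the invariants of positive degree as soon as k > i. *)
Lemma in_Phi_hsq D k i a : (forall m, (mdeg m < D)%N -> in_Phi 'X_[m]) ->
  (i <= n)%N -> (i < k)%N -> (mdeg a + 2 * k <= D)%N -> in_Phi ('X_[a] * hsq k i).
Proof.
move=> hD; elim: i k a => [|i IH] [//|k] a lein ltik leD.
  by apply: in_Phi_invariant (hsq0_invariant _) (hD _ _); lia.
have -> : hsq k.+1 i.+1 = hsq k.+1 i - 'X_(Ordinal lein) ^+ 2 * hsq k i.
  by have := hsq_rec k (Ordinal lein).
rewrite mulrBr mulrA mpolyXn -mpolyXD.
apply: in_PhiB; apply: IH; rewrite ?mdegD ?mdegMn ?mdeg1; lia.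
Qed.

(** Induction along the monomial order, degree first and then lexicographic. If x^m is not Artin, it
    is x^a times the leading monomial of some [hsq k i]; that product lies in the image by
    [in_Phi_hsq], and its other monomials are smaller. *)
Lemma in_PhiX m : in_Phi 'X_[m].
Proof.
suff {m} h (m : 'X_{1..n}) :
    (forall m' : 'X_{1..n}, (m' < m)%O -> in_Phi 'X_[m']) -> in_Phi 'X_[m].
  exact: (ltmwf h).
move=> IH.
have [art|nart] := boolP (artin m).
  by exists 'X_[m]; rewrite PhiX artin_basis_artin.
case: (forallPn nart) => i; rewrite -leqNgt => lemi.
(* k = i + 1 is the least degree allowed by [in_Phi_hsq], and x_i^(2k) divides x^m because m
   violates the Artin bound at i. *)
pose k := i.+1; pose a := (m - U_(i) *+ k *+ 2)%MM.
have mE : (a + U_(i) *+ k *+ 2)%MM = m.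
  apply: submK; apply/mnm_lepP => j; rewrite !mulmnE mnm1E.
  by case: eqP => [<-|_]; rewrite /k; lia.
have hD m' : (mdeg m' < mdeg m)%N -> in_Phi 'X_[m'].
  by move=> ltm; apply: IH; exact: lt_mdeg_ltmc.
have da : (mdeg a + 2 * k <= mdeg m)%N.
  by rewrite -[m in leqRHS]mE mdegD !mdegMn mdeg1; lia.
have := in_Phi_hsq hD (ltnW (ltn_ord i)) (ltnSn i) da.
have dk : (mdeg (U_(i) *+ k : 'X_{1..n})%MM < k.+1)%N by rewrite mdegMn mdeg1 mul1n.
rewrite /hsq (bigD1 (BMultinom dk)) /=; last by rewrite mdegMn mdeg1 mul1n.
rewrite ifT; last first.
  apply/forallP => j; apply/implyP => ltj; rewrite mulmnE mnm1E.
  by rewrite -[i == j]val_eqE /= (gtn_eqF ltj).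
rewrite mulrDr -mpolyXD mE => hX.
rewrite -['X_[m]](addrK ('X_[a] * \sum_(b : 'X_{1..n < k.+1} |
   (mdeg b == k) && (b != BMultinom dk)) (if supp_ge i b then 'X_[b *+ 2] else 0))).
apply: in_PhiB hX _; rewrite mulr_sumr; apply: in_Phi_sum => b /andP[/eqP db nb].
case: ifP => [/forallP sb|_]; last by rewrite mulr0; exact: in_Phi0.
rewrite -mpolyXD; apply: IH; rewrite -[X in (_ < X)%O]mE ltmc_add2r.
(* A b of degree k other than the k-fold of [U_(i)] has exponent below k at i; as it vanishes before
   i, it is lexicographically smaller. *)
have bi : (b i < k)%N.
  have : (b i <= mdeg b)%N by rewrite mdegE (bigD1 i) //= leq_addr.
  rewrite db leq_eqVlt => /orP[/eqP bik|//]; case/negP: nb; apply/eqP/val_inj/mnmP => j.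
  rewrite /= mulmnE mnm1E; case: eqP => [<-|/eqP ij]; first by rewrite mul1n.
  move: db; rewrite mdegE (bigD1 i) //= bik (bigD1 j) 1?eq_sym //= mul0n; lia.
apply/ltmcP; first by rewrite !mdegMn mdeg1 mul1n db.
exists i => [j ltj|]; rewrite !mulmnE mnm1E.
  rewrite -[i == j]val_eqE /= (gtn_eqF ltj); have := sb j; rewrite ltj /= => /eqP ->.
  by rewrite !mul0n.
by rewrite eqxx mul1n ltn_mul2r bi.
Qed.

Lemma in_PhiX_homog m : exists2 q, q \is (mdeg m).-homog & Phi q = 'X_[m].
Proof.
have [q qE] := in_PhiX m; exists (pihomog mdeg (mdeg m) q); first exact: pihomogP.
by rewrite Phi_pihomog qE pihomogX eqxx.
Qed.

(** Surjectivity forces injectivity in finite dimension: up to the size of p, homogeneous preimages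
    of the monomials form a one-sided inverse of the matrix of [Phi], which is two-sided because the
    matrices are square. *)
Lemma Phi_inj : injective Phi.
Proof.
suff Phi0 p : Phi p = 0 -> p = 0.
  move=> p q /eqP; rewrite -subr_eq0 -raddfB => /eqP/Phi0/eqP.
  by rewrite subr_eq0 => /eqP.
move=> Pp; pose J := 'X_{1..n < msize p}; pose N := #|{: J}|.
pose b (j : 'I_N) : 'X_{1..n} := enum_val j.
have bsum (V : nmodType) (G : 'X_{1..n} -> V) :
    \sum_(m : J) G m = \sum_(j < N) G (b j).
  by rewrite -(big_enum_val (A := {: J}) (fun m : J => G m)).
have b_inj : injective b by move=> j j' /val_inj /enum_val_inj.
have [q qh qE] : exists2 q : 'X_{1..n} -> S, (forall m, q m \is (mdeg m).-homog)
    & forall m, Phi (q m) = 'X_[m].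
  have ex m : exists q, q \is (mdeg m).-homog /\ Phi q = 'X_[m].
    by have [q ? ?] := in_PhiX_homog m; exists q.
  by have [q qP] := choice ex; exists q => m; case: (qP m).
pose P : 'M[F]_N := \matrix_(j, l) (artin_basis (b j))@_(b l).
pose Q : 'M[F]_N := \matrix_(j, l) (q (b j))@_(b l).
have msize_homog (f : S) (m : 'X_{1..n}) : 
    f \is (mdeg m).-homog -> (mdeg m < msize p)%N -> (msize f <= msize p)%N.
  move=> hf ltm; rewrite msizeE; apply/bigmax_leqP_seq => m' m'f _.
  by rewrite (dhomogP _ _ _ hf m' m'f).
have QP : Q *m P = 1%:M.
  apply/matrixP => j l; rewrite !mxE.
  have := congr1 (mcoeff (b l)) (qE (b j)).
  rewrite mcoeffX (inj_eq b_inj) => <-.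
  rewrite /Phi (@lin_extwE _ _ _ _ (msize p)); last first.
    by apply: msize_homog (qh _) _; exact: bmdeg.
  rewrite (bsum _ (fun m => (q (b j))@_m *: artin_basis m)) mcoeff_sum.
  by apply: eq_bigr => h _; rewrite !mxE mcoeffZ.
pose u : 'rV[F]_N := \row_j p@_(b j).
have u0 : u = 0.
  rewrite -[u]mulmx1 -(mulmx1C QP) mulmxA (_ : u *m P = 0) ?mul0mx //.
  apply/matrixP => i l; rewrite !mxE.
  transitivity ((Phi p)@_(b l)); last by rewrite Pp mcoeff0.
  rewrite /Phi (@lin_extwE _ _ _ _ (msize p)) //.
  rewrite (bsum _ (fun m => p@_m *: artin_basis m)) mcoeff_sum.
  by apply: eq_bigr => h _; rewrite !mxE mcoeffZ.
rewrite (@mpolywE _ _ (msize p) p) // (bsum _ (fun m => p@_m *: 'X_[m])) big1 // => j _.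
by have := congr1 (fun v : 'rV_N => v 0 j) u0; rewrite !mxE => ->; rewrite scale0r.
Qed.
End ArtinBasis.

(** * Traces on the coinvariant algebra *)

Section IndexedTrace.
Context {F : fieldType} {V : lmodType F} (W : V -> Prop) (f : V -> V).
Context {J : finType} (P : pred J) (b : J -> V) (M : J -> J -> F).

Lemma is_trace_indexed :
    (forall j, P j -> W (b j)) ->
    (forall c : J -> F, \sum_(j | P j) c j *: b j = 0 -> forall j, P j -> c j = 0) ->
    (forall w, W w -> exists c : J -> F, w = \sum_(j | P j) c j *: b j) ->
    (forall j, P j -> f (b j) = \sum_(k | P k) M j k *: b k) ->
  is_trace W f (\sum_(j | P j) M j j).
Proof.
move=> bW bfree bgen fb; pose e (i : 'I_#|P|) : J := enum_val i.
have eP i : P (e i) by exact: enum_valP.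
have esum (U : nmodType) (G : J -> U) : \sum_(j | P j) G j = \sum_i G (e i).
  exact: (big_enum_val (A := P)).
exists #|P|, (b \o e), (\matrix_(i, k) M (e i) (e k)); split.
- split=> [i|c|w /bgen[c ->]]; first exact/bW/eP.
    (* Coefficients on ordinals are carried to [J] by summing over fibres; [enum_val] is injective,
       so each fibre has at most one index. *)
    pose c' j := \sum_(i | e i == j) c i.
    have c'E i : c' (e i) = c i.
      by rewrite /c' (big_pred1 i) // => k; exact: (inj_eq enum_val_inj).
    move=> c0 i; rewrite -c'E; apply: bfree (eP i).
    by rewrite esum -[RHS]c0; apply: eq_bigr => k _; rewrite c'E.
  by exists (c \o e); rewrite esum.
- by move=> i /=; rewrite fb // esum; apply: eq_bigr => k _; rewrite mxE.
- by rewrite esum /mxtrace; apply: eq_bigr => i _; rewrite mxE.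
Qed.
End IndexedTrace.

Section HomogeneousTrace.
Context {F : fieldType} {n : nat}.
Local Notation S := {mpoly F[n]}.

Lemma dhomog_sumE (p : S) d : p \is d.-homog ->
  p = \sum_(m : 'X_{1..n < d.+1} | mdeg m == d) p@_m *: 'X_[m].
Proof.
move=> hp; rewrite -{1}(pihomog_dE hp); apply: pihomogwE.
rewrite msizeE; apply/bigmax_leqP_seq => m mp _.
by rewrite ltnS (dhomogP _ _ _ hp m mp).
Qed.

Lemma mcoeff_sumX d (c : 'X_{1..n < d.+1} -> F) (Q : pred 'X_{1..n < d.+1}) j :
  Q j -> (\sum_(m | Q m) c m *: 'X_[m] : S)@_j = c j.
Proof.
move=> Qj; rewrite mcoeff_sum (bigD1 j) //= mcoeffZ mcoeffX eqxx mulr1.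
rewrite big1 ?addr0 // => m /andP[_ mj]; rewrite mcoeffZ mcoeffX.
by rewrite (inj_eq val_inj) (negPf mj) mulr0.
Qed.

(** The trace is read off in the basis of the [phi 'X_[m]], whose coordinates are the coefficients
    of [psi]. The instances for [Phi] and for the identity are compared later. *)
Lemma is_trace_dhomog (d : nat) (phi psi f : {linear mpoly n F -> mpoly n F}) :
    cancel phi psi -> cancel psi phi ->
    (forall p : S, p \is d.-homog -> phi p \is d.-homog) ->
    (forall p : S, p \is d.-homog -> psi p \is d.-homog) ->
    (forall p : S, p \is d.-homog -> f p \is d.-homog) ->
  is_trace (fun p : S => p \is d.-homog) f
    (\sum_(m : 'X_{1..n < d.+1} | mdeg m == d) (psi (f (phi 'X_[m])))@_m).
Proof.
move=> phiK psiK hphi hpsi hf.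
have genE (p : S) : p \is d.-homog ->
    p = \sum_(m : 'X_{1..n < d.+1} | mdeg m == d) (psi p)@_m *: phi 'X_[m].
  move=> hp; rewrite -{1}[p]psiK {1}[psi p](dhomog_sumE (hpsi _ hp)) linear_sum.
  by apply: eq_bigr => m _; rewrite linearZ.
have hX (m : 'X_{1..n < d.+1}) : mdeg m == d -> phi 'X_[m] \is d.-homog.
  by move=> dm; apply: hphi; rewrite dhomogX.
apply: (is_trace_indexed (P := fun m : 'X_{1..n < d.+1} => mdeg m == d)
  (b := fun m => phi 'X_[m]) (M := fun m k => (psi (f (phi 'X_[m])))@_k)).
- exact: hX.
- move=> c c0 j dj; have := congr1 (mcoeff j \o psi) c0; rewrite /= raddf0 mcoeff0.
  rewrite linear_sum /=; under eq_bigr do rewrite linearZ /= phiK.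
  by rewrite (mcoeff_sumX c (Q := fun m => mdeg (bmnm m) == d)).
- by move=> p /genE ->; exists (fun m : 'X_{1..n < d.+1} => (psi p)@_m).
- by move=> j dj; apply/genE/hf/hX.
Qed.
End HomogeneousTrace.

Section CoinvariantTrace.
Context {F : fieldType} {n : nat}.
Local Notation S := {mpoly F[n]}.
Context (two_neq0 : 2%:R != 0 :> F).

Lemma Phi_linear_bij : exists psi : {linear mpoly n F -> mpoly n F},
  cancel Phi psi /\ cancel psi Phi.
Proof.
have ex m : exists q : S, Phi q = 'X_[m] by exact: in_PhiX.
have [q qE] := choice ex; exists (lin_ext q).
have psiK : cancel (lin_ext q) Phi.
  pose f1 : {linear mpoly n F -> mpoly n F} := Phi \o lin_ext q.
  by apply: (@eq_linear_mpolyX _ _ _ f1 idfun) => m; rewrite /f1 /= lin_extX.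
by split=> // p; apply: (Phi_inj two_neq0); rewrite psiK.
Qed.

Context (Psi : {linear mpoly n F -> mpoly n F}).
Context (PhiK : cancel Phi Psi) (PsiK : cancel Psi Phi).

Lemma Psi_emon v p : Psi (emon v * p) = 'X_[wmon v] * Psi p.
Proof. by apply: (can_inj PhiK); rewrite PsiK Phi_wmon PsiK. Qed.

Lemma Phi_dhomog d (p : S) : p \is d.-homog -> Phi p \is d.-homog.
Proof. by move=> hp; rewrite homog_piE -Phi_pihomog pihomog_dE. Qed.

Lemma Psi_dhomog d (p : S) : p \is d.-homog -> Psi p \is d.-homog.
Proof.
move=> hp; rewrite homog_piE; apply/eqP/(can_inj PhiK).
by rewrite Phi_pihomog PsiK pihomog_dE.
Qed.

Lemma artin_wmon (v m : 'X_{1..n}) : v != 0%MM -> ~~ artin (wmon v + m)%MM.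
Proof.
apply: contra => /forallP art; apply/eqP/mnmP => i; have := art i.
by rewrite mnmDE mnmE mnm0E; case: (v i) => // k; rewrite mulnS; lia.
Qed.

Lemma mcoeff_wmonM v (p : S) m : artin m -> v != 0%MM -> ('X_[wmon v] * p)@_m = 0.
Proof.
move=> art v0; apply: memN_msupp_eq0; rewrite mulrC (perm_mem (msuppMX p (wmon v))).
by apply/negP => /mapP[m' _ mE]; have := artin_wmon m' v0; rewrite -mE art.
Qed.

(** [Psi] turns multiplication by [emon v] into multiplication by x^(wmon v), which for nonzero v
    has no Artin multiples. This gives independence of the Artin monomials modulo the ideal. *)
Lemma coinv_ideal_Psi (p : S) m :
  p \in coinv_ideal (F := F) (n := n) -> artin m -> (Psi p)@_m = 0.
Proof.
move=> /asboolP[l [lP ->]] art.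
rewrite linear_sum mcoeff_sum big_seq big1 // => x /lP[inv_x x0].
have [t xE] := sp_invariant_emon two_neq0 inv_x.
rewrite xE comp_esqE mulr_sumr linear_sum mcoeff_sum big1 // => v _.
have -> : x.1 * (t@_v *: emon v) = t@_v *: (emon v * x.1).
  by rewrite -scalerAr mulrC.
rewrite linearZ /= Psi_emon mcoeffZ.
(* For v = 0 the coefficient of t is the constant term of the generator, which vanishes. *)
have [->|v0] := eqVneq v 0%MM; last by rewrite mcoeff_wmonM // mulr0.
by rewrite -mcoeff0_comp_esq -xE x0 mul0r.
Qed.

(** The quotient part is then an invariant of positive degree. Hence the Artin monomials span the
    coinvariant algebra. *)
Lemma artin_basis_ideal (m : 'X_{1..n}) : ~~ artin m ->
  (artin_basis m : S) \in coinv_ideal (F := F) (n := n).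
Proof.
move=> nart; have q0 : artin_quo m != 0%MM.
  apply: contra nart => /eqP/mnmP q0; apply/forallP => i.
  have := q0 i; rewrite mnmE mnm0E => e.
  by rewrite (divn_eq (m i) (2 * i.+1)) e mul0n add0n ltn_pmod.
apply/asboolP; exists [:: ('X_[artin_rem m], emon (artin_quo m))].
split; last by rewrite big_seq1.
move=> x; rewrite inE => /eqP -> /=; split; first exact: emon_invariant.
rewrite (dhomog_nemf_coeff (emon_dhomog _)) //= mdeg0 eq_sym.
by rewrite mdeg_wmon_eq0.
Qed.

Section Action.
Context (s : signed_perm n).

Definition artin_weight (m : 'X_{1..n}) : F := (Psi (sp_act s (artin_basis m)))@_m.

(** s fixes [emon v], so its action commutes with multiplication by it. *)
Lemma artin_weight_wmon m v : artin_weight (m + wmon v)%MM = artin_weight m.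
Proof.
rewrite /artin_weight addmC artin_basis_wmon rmorphM /= emon_invariant Psi_emon.
by rewrite mulrC mcoeffMX.
Qed.

(** In each degree both sides are the trace of s on the same space, in two bases. *)
Lemma mseries_artin_weight : mseries artin_weight = mseries (diag_weight s).
Proof.
apply: fpsP => d; rewrite !mseriesE.
have hs (p : S) : p \is d.-homog -> sp_act s p \is d.-homog by exact: sp_act_dhomog.
have t1 := is_trace_dhomog (phi := Phi) (f := sp_act s) PhiK PsiK
  (@Phi_dhomog d) (@Psi_dhomog d) hs.
have t2 := is_trace_dhomog (phi := idfun) (psi := idfun) (f := sp_act s)
  (fun _ => erefl) (fun _ => erefl) (fun _ => id) (fun _ => id) hs.
transitivity (\sum_(m : 'X_{1..n < d.+1} | mdeg m == d)
    (Psi (sp_act s (Phi 'X_[m])))@_m).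
  by apply: eq_bigr => m _; rewrite PhiX.
exact: is_trace_uniq t1 t2.
Qed.

Lemma coinv_pi_dhomog d (p : S) : p \is d.-homog ->
  coinv_pi p = \sum_(m : 'X_{1..n < d.+1} | (mdeg m == d) && artin m)
                 (Psi p)@_m *: coinv_pi (artin_basis m).
Proof.
move=> hp; rewrite -{1}[p]PsiK {1}[Psi p](dhomog_sumE (Psi_dhomog hp)).
rewrite linear_sum raddf_sum big_mkcondr; apply: eq_bigr => m _ /=.
rewrite linearZ /= PhiX coinv_piZ; case: ifPn => // nart.
have -> : coinv_pi (artin_basis m : S) = coinv_pi 0.
  by apply/coinv_piP; rewrite subr0; exact: artin_basis_ideal.
by rewrite -coinv_piZ scaler0 raddf0.
Qed.

(** The classes of the Artin monomials span by [coinv_pi_dhomog] and are independent by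
    [coinv_ideal_Psi]. *)
Lemma is_trace_coinv d : is_trace (coinv_graded (F := F) (n := n) d) (coinv_act s)
  (\sum_(m : 'X_{1..n < d.+1} | (mdeg m == d) && artin m) artin_weight m).
Proof.
have hB (m : 'X_{1..n < d.+1}) : (mdeg m == d) && artin m ->
    (artin_basis m : S) \is d.-homog.
  by move=> /andP[/eqP dm _]; have := artin_basis_dhomog (F := F) m; rewrite dm.
apply: (is_trace_indexed (P := fun m : 'X_{1..n < d.+1} => (mdeg m == d) && artin m)
  (b := fun m => coinv_pi (artin_basis m))
  (M := fun m k => (Psi (sp_act s (artin_basis m)))@_k)).
- by move=> m /hB hm; exists (artin_basis m).
- move=> c c0 j Pj; have /coinv_piP : coinv_pi (\sum_(m : 'X_{1..n < d.+1} |
      (mdeg m == d) && artin m) c m *: (artin_basis m : S)) = coinv_pi 0.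
    by rewrite !raddf0 -c0 raddf_sum; apply: eq_bigr => m _; rewrite -coinv_piZ.
  rewrite subr0 => /coinv_ideal_Psi /(_ (proj2 (andP Pj))).
  rewrite linear_sum /=; under eq_bigr do rewrite linearZ /= -PhiX PhiK.
  by rewrite (mcoeff_sumX c (Q := fun m => (mdeg (bmnm m) == d) && artin m)).
- move=> u [p hp ->]; exists (fun m : 'X_{1..n < d.+1} => (Psi p)@_m).
  exact: coinv_pi_dhomog.
- by move=> m /hB hm; rewrite coinv_act_pi; apply/coinv_pi_dhomog/sp_act_dhomog.
Qed.

Lemma coinv_charE d : coinv_char F d s
  = fcoef (mseries (fun m => if artin m then artin_weight m else 0)) d.
Proof.
rewrite /coinv_char (trace_onE (is_trace_coinv d)) mseriesE.
by rewrite big_mkcondr.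
Qed.

Lemma wmon1_le (i : 'I_n) m : (wmon U_(i) <= m)%MM = (2 * i.+1 <= m i)%N.
Proof.
apply/mnm_lepP/idP => [/(_ i)|h j]; rewrite mnmE mnm1E ?eqxx ?muln1 //.
by case: eqP => [<-|_]; rewrite ?muln1 ?muln0.
Qed.

Lemma mdeg_wmon1 (i : 'I_n) : mdeg (wmon U_(i)) = (2 * i.+1)%N.
Proof.
rewrite mdegE (bigD1 i) //= mnmE mnm1E eqxx muln1 big1 ?addn0 // => j ji.
by rewrite mnmE mnm1E eq_sym (negPf ji) muln0.
Qed.

(** Sieving by the [wmon U_(i)], of degrees 2, 4, ..., 2n, leaves exactly the Artin exponents; all
    signs are positive since s fixes the generators. *)
Lemma mseries_coinv :
  mseries (fun m => if artin m then artin_weight m else 0)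
  = (\prod_(1 <= k < n.+1) (1 - ft ^+ (2 * k))) * mseries (diag_weight s) :> fps F.
Proof.
rewrite -mseries_artin_weight big_add1 /= big_mkord.
transitivity ((\prod_(i <- enum 'I_n) fsign_binom false (mdeg (wmon U_(i) : 'X_{1..n})))
    * mseries artin_weight); last first.
  congr (_ * _); rewrite big_enum /=; apply: eq_bigr => i _.
  by rewrite mdeg_wmon1 /fsign_binom expr0 mul1r.
rewrite (mseries_prod_shift (v := fun i : 'I_n => wmon U_(i)) (b := fun=> false)).
- apply: eq_mseries => m; congr (if _ then _ else _).
  apply/forallP/allP => h i; first by move=> _; rewrite wmon1_le -ltnNge; exact: h.
  by have := h i; rewrite mem_enum wmon1_le -ltnNge; apply.
- exact: enum_uniq.
- by move=> i m _ _; rewrite artin_weight_wmon expr0 mul1r.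
- move=> i j _ _ ij m; rewrite !wmon1_le mnmDE mnmE mnm1E eq_sym (negPf ij).
  by rewrite muln0 addn0.
Qed.
End Action.
End CoinvariantTrace.

(** * Comparison of the characters with the Q_i *)

Lemma coinv_char_Qpoly (F : numFieldType) (n i : nat) (s : signed_perm n) :
  (i <= 2 * n + 1)%N ->
  coinv_char F i s = ratr (charpoly_eval s (Qpoly i)).
Proof.
move=> lei; have two_neq0 : 2%:R != 0 :> F by rewrite Num.Theory.pnatr_eq0.
have [Psi [PhiK PsiK]] := Phi_linear_bij (n := n) two_neq0.
rewrite (coinv_charE two_neq0 PhiK PsiK) (mseries_coinv PhiK PsiK).
(* N exceeds i, so the partial product already has the final coefficient of t^i, and n, so it covers
   all cycle lengths. *)
pose N := (maxn i n).+1; set GS := mseries _.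
pose h : {rmorphism fps charpoly -> fps F} := fps_map (evalF s).
pose EN := h (\prod_(1 <= k < N) factor_frac k).
have -> : ratr (charpoly_eval s (Qpoly i)) = fcoef EN i :> F.
  by rewrite -(@Qpoly_stable i N) // ltnS leq_maxl.
set D := \prod_(1 <= k < N) ((1 - ft ^+ k) ^+ ncycles s false k
                        * (1 + ft ^+ k) ^+ ncycles s true k) : fps F.
have DG : D * GS = 1.
  by rewrite /D prod_ncycles ?ltnS ?leq_maxr // mseries_diag_weight.
have ED : EN * D = \prod_(1 <= k < N) (1 - ft ^+ (2 * k)).
  rewrite /EN rmorph_prod -big_split; apply: eq_big_nat => k /andP[k0 _].
  exact: evalF_factor_frac.
(* Since [D] is inverse to the trace series on S, [EN] is that series times the product of the 1 -
   t^(2k) with k < N, split here after k = n. *)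
have -> : EN = (\prod_(1 <= k < n.+1) (1 - ft ^+ (2 * k))) * GS
    * \prod_(n.+1 <= k < N) (1 - ft ^+ (2 * k)).
  transitivity (EN * (D * GS)); first by rewrite DG mulr1.
  rewrite mulrA ED mulrAC; congr (_ * _).
  have leN : (n.+1 <= N)%N by rewrite /N ltnS leq_maxr.
  exact: big_cat_nat.
(* The factors with k > n are 1 modulo t^(2n+2): this is where the bound 2n + 1 on i comes from. *)
apply: esym; apply: (@fone_modM_coef _ (2 * n.+1)%N); last by lia.
rewrite big_nat; elim/big_rec: _ => [//|k f /andP[lek _] hf].
apply: fone_modM hf => j ltj.
transitivity (fcoef (1 : fps F) j - fcoef (ft ^+ (2 * k) : fps F) j); first by [].
by rewrite fcoef_ftX fcoef1 [(j == 2 * k)%N]ltn_eqF ?subr0 //; lia.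
Qed.

Theorem theorem1p9 (R : realType) :
  [/\ is_fprod factor_frac (Fps Qpoly),
      is_fprod factor_bin (Fps Qpoly)
    & forall (n i : nat), (1 <= n)%N -> (i <= 2 * n + 1)%N ->
      forall s : signed_perm n,
        coinv_char (complex R) i s = ratr (charpoly_eval s (Qpoly i))].
Proof.
split; [exact: is_fprod_factor_frac | exact: is_fprod_factor_bin |].
by move=> n i _ lei s; exact: coinv_char_Qpoly.
Qed.
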